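(* There are universal constants $c,C,C_1,C_2>0$ such that the following holds. Let $\beta^*\in\mathbb{R}^p$ have exactly $k$ non-zero entries. Let $X\in\mathbb{R}^{n\times p}$ and $\mathbf{e}\in\mathbb{R}^n$ follow the independent sub-Gaussian design model with parameters $\frac1n$ and $\frac1n\sigma_e^2$, and let $\mathbf{y}=X\beta^*+\mathbf{e}$. Let $\rho\in[0,1)$ and let $Z\in\mathbb{R}^{n\times p}$ be obtained from $X$ by replacing each entry by $0$ with probability $\rho$ and leaving it unchanged with probability $1-\rho$, independently over entries and independently of $X$ and $\mathbf{e}$ (missing data model). Suppose $$n\ge c\,\frac1{(1-\rho)^4}\,k\log p$$ and every non-zero entry of $\beta^*$ is greater in absolute value than $$\frac{16}{1-\rho}\left(\|\beta^*\|_2+\sigma_e\right)\sqrt{\frac{\log p}{n}} .$$ Then, with probability at least $1-C_1p^{-C_2}$, the output $\hat\beta$ of mod-OMP on input $(Z,\mathbf{y},k)$, with final estimate built from $\hat\Sigma_{I,I}=(Z_I^\top Z_I)\odot M$ and $\hat\gamma_I=\frac1{1-\rho}Z_I^\top\mathbf{y}$, where $M\in\mathbb{R}^{k\times k}$ has diagonal entries $\frac1{1-\rho}$ and off-diagonal entries $\frac1{(1-\rho)^2}$, satisfies $$\|\hat\beta-\beta^*\|_2\le C\left(\frac1{(1-\rho)^2}\|\beta^*\|_2+\frac1{1-\rho}\sigma_e\right)\sqrt{\frac{k\log p}{n}} .$$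
   Context: A zero-mean real random variable $v$ is sub-Gaussian with parameter $\sigma_v$ if $\mathbb{E}[\exp(\lambda v)]\le\exp(\sigma_v^2\lambda^2/2)$ for all $\lambda\in\mathbb{R}$. Independent sub-Gaussian design model: all entries of $X$ and $\mathbf{e}$ are zero-mean and mutually independent; the entries of $X$ have variance $\frac1n$ and are sub-Gaussian with parameter $\frac1{\sqrt n}$, and the entries of $\mathbf{e}$ are sub-Gaussian with parameter $\frac{\sigma_e}{\sqrt n}$. Algorithm mod-OMP, on input $(Z,\mathbf{y},k)$: initialize $I=\emptyset$, $I^c=\{1,\dots,p\}$, $\mathbf{r}=\mathbf{y}$. For $j=1,\dots,k$: compute $h_i=Z_i^\top\mathbf{r}$ for $i\in I^c$ ($Z_i$ is the $i$-th column of $Z$); let $i^*\in\arg\max_{i\in I^c}|h_i|$; set $I\leftarrow I\cup\{i^*\}$ and $I^c=\{1,\dots,p\}\setminus I$; update $\mathbf{r}=\mathbf{y}-Z_I(Z_I^\top Z_I)^{-1}Z_I^\top\mathbf{y}$. After the loop, output $\hat\beta$ with $\hat\beta_I=\hat\Sigma_{I,I}^{-1}\hat\gamma_I$ and $\hat\beta_{I^c}=0$. $Z_I$ is the submatrix of columns of $Z$ indexed by $I$; $\odot$ is the entrywise product. Universal constants do not depend on $n,p,k,\rho$ or any of the variance parameters. *)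

(* Defs.v *)
From HB Require Import structures.
From mathcomp Require Import all_boot all_order all_algebra.
From mathcomp Require Import all_classical all_reals all_analysis.

Set Implicit Arguments.
Unset Strict Implicit.
Unset Printing Implicit Defensive.

Import Order.TTheory GRing.Theory Num.Theory.
Import numFieldNormedType.Exports.

Local Open Scope classical_set_scope.
Local Open Scope ring_scope.

(* The norm `|v| that MathComp-Analysis puts on matrices is the sup norm. *)
Definition l2norm (R : realType) (m : nat) (v : 'cV[R]_m) : R :=
  Num.sqrt (\sum_(i < m) v i 0 ^+ 2).

Section Probability.
Context {d : measure_display} {T : measurableType d} {R : realType}.
Variable P : probability T R.

Definition mutually_independent (I : finType) (V : I -> {RV P >-> R}) : Prop :=
  forall (J : {set I}) (A : I -> set R), (forall i, measurable (A i)) ->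
    (P (\bigcap_(i in [set` J]) V i @^-1` A i) =
     \prod_(i in J) P (V i @^-1` A i))%E.

Definition zero_mean (v : {RV P >-> R}) : Prop := 'E_P[v]%E = 0%E.

Definition sub_gaussian (s : R) (v : {RV P >-> R}) : Prop :=
  zero_mean v /\
  forall l : R, ('M_P v l <= (expR (s ^+ 2 * l ^+ 2 / 2))%:E)%E.

Definition random_mx (m q : nat) (V : 'I_m -> 'I_q -> {RV P >-> R}) (w : T) :
  'M[R]_(m, q) := \matrix_(i, j) V i j w.

Definition random_cV (m : nat) (v : 'I_m -> {RV P >-> R}) (w : T) : 'cV[R]_m :=
  \col_i v i w.

Definition design_entries (n p : nat) (X : 'I_n -> 'I_p -> {RV P >-> R})
    (e : 'I_n -> {RV P >-> R}) (a : 'I_n * 'I_p + 'I_n) : {RV P >-> R} :=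
  match a with inl ij => X ij.1 ij.2 | inr i => e i end.

Definition sub_gaussian_design (n p : nat) (sigma_e : R)
    (X : 'I_n -> 'I_p -> {RV P >-> R}) (e : 'I_n -> {RV P >-> R}) : Prop :=
  [/\ mutually_independent (design_entries X e),
      forall i j, 'V_P[X i j]%E = (n%:R^-1)%:E,
      forall i j, sub_gaussian (Num.sqrt n%:R)^-1 (X i j) &
      forall i, sub_gaussian (sigma_e / Num.sqrt n%:R) (e i)].

Definition masked_entries (n p : nat) (X : 'I_n -> 'I_p -> {RV P >-> R})
    (e : 'I_n -> {RV P >-> R}) (B : 'I_n -> 'I_p -> {RV P >-> R})
    (a : 'I_n * 'I_p + 'I_n + 'I_n * 'I_p) : {RV P >-> R} :=
  match a with inl b => design_entries X e b | inr ij => B ij.1 ij.2 end.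

(* Z is X multiplied entrywise by a Bernoulli(1 - rho) mask B.  When the
   entries of X and e are mutually independent, joint mutual independence of
   all the entries of X, e and B says exactly that the entries of B are
   mutually independent and that B is independent of (X, e). *)
Definition missing_data (n p : nat) (rho : R)
    (X : 'I_n -> 'I_p -> {RV P >-> R}) (e : 'I_n -> {RV P >-> R})
    (Z : 'I_n -> 'I_p -> {RV P >-> R}) : Prop :=
  exists B : 'I_n -> 'I_p -> {RV P >-> R},
    [/\ mutually_independent (masked_entries X e B),
        forall i j, P (B i j @^-1` [set 0]) = rho%:E,
        forall i j, P (B i j @^-1` [set 1]) = (1 - rho)%:E,
        forall i j w, B i j w = 0 \/ B i j w = 1 &
        forall i j w, Z i j w = B i j w * X i j w].

(* The event E is not required to be measurable: a measurable subevent of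
   probability at least q is. *)
Definition with_probability_at_least (q : R) (E : set T) : Prop :=
  exists A : set T, [/\ measurable A, A `<=` E & (q%:E <= P A)%E].

End Probability.

Section ModOMP.
Context {R : realType} {n p : nat}.
Variables (Z : 'M[R]_(n, p)) (y : 'cV[R]_n).

Definition cols (I : {set 'I_p}) : 'M[R]_(n, #|I|) := colsub enum_val Z.

Definition gram (I : {set 'I_p}) : 'M[R]_#|I| := (cols I)^T *m cols I.

Definition residual (I : {set 'I_p}) : 'cV[R]_n :=
  y - cols I *m invmx (gram I) *m (cols I)^T *m y.

Definition correlation (r : 'cV[R]_n) (i : 'I_p) : R := ((col i Z)^T *m r) 0 0.

(* omp_state j I r: (I, r) is a possible state after j passes through the
   loop; it is a relation because ties in the argmax are broken arbitrarily. *)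
Inductive omp_state : nat -> {set 'I_p} -> 'cV[R]_n -> Prop :=
| omp_init : omp_state 0 finset.set0 y
| omp_step (j : nat) (I : {set 'I_p}) (r : 'cV[R]_n) (i0 : 'I_p) :
    omp_state j I r ->
    i0 \notin I ->
    (forall i, i \notin I -> `|correlation r i| <= `|correlation r i0|) ->
    omp_state j.+1 (i0 |: I) (residual (i0 |: I)).

Definition missing_weights (rho : R) (m : nat) : 'M[R]_m :=
  \matrix_(a, b) if a == b then (1 - rho)^-1 else ((1 - rho) ^+ 2)^-1.

Definition Sigma_hat (rho : R) (I : {set 'I_p}) : 'M[R]_#|I| :=
  map2_mx *%R (gram I) (missing_weights rho #|I|).

Definition gamma_hat (rho : R) (I : {set 'I_p}) : 'cV[R]_#|I| :=
  (1 - rho)^-1 *: ((cols I)^T *m y).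

(* The vector of R^p whose restriction to I is b and which is 0 off I. *)
Definition zero_extend (I : {set 'I_p}) (b : 'cV[R]_#|I|) : 'cV[R]_p :=
  \col_i \sum_(a < #|I| | enum_val a == i) b a 0.

(* mod_omp_run rho k I b: some run of the algorithm selects the support I and
   outputs b. *)
Definition mod_omp_run (rho : R) (k : nat) (I : {set 'I_p}) (b : 'cV[R]_p) :
    Prop :=
  (exists r, omp_state k I r) /\
  b = zero_extend (invmx (Sigma_hat rho I) *m gamma_hat rho I).

(* Every run is well defined and its output b satisfies Q.  Since invmx is
   total, invertibility is demanded explicitly; that of gram I for the final
   I gives that of gram J for all the J included in I met along the run.
   For k <= p, at least one run exists. *)
Definition mod_omp_output_satisfies (rho : R) (k : nat) (Q : 'cV[R]_p -> Prop) :
    Prop :=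
  forall (I : {set 'I_p}) (b : 'cV[R]_p), mod_omp_run rho k I b ->
    [/\ gram I \in unitmx, Sigma_hat rho I \in unitmx & Q b].

End ModOMP.

(* Main.v *)
Require Import Defs.
From HB Require Import structures.
From mathcomp Require Import all_boot all_order all_algebra.
From mathcomp Require Import all_classical all_reals all_analysis.
From mathcomp Require Import measurable_realfun ring lra zify.
Import Order.TTheory GRing.Theory Num.Theory.
Import numFieldNormedType.Exports.
Local Open Scope classical_set_scope.
Local Open Scope ring_scope.

Set Implicit Arguments.
Unset Strict Implicit.
Unset Printing Implicit Defensive.
Set SsrOldRewriteGoalsOrder.

(** Write [q = 1 - rho], [S = |beta| + sigma_e], and let [tau] be a constant
multiple of [sqrt (k log p / n)]; the sample size condition makes [tau] a small
multiple of [q ^ 2]. Two kinds of bounds hold with high probability, with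
constants that are universal.

- Restricted isometry: [<Z u, Z v> = q <u, v> + O(tau |u| |v|)] and
  [<Z u, y> = q <u, beta> + O(tau S |u|)] for all [u] and [v] supported on a
  common set of [2 k] indices.
- For every sequence of [k] distinct indices that a run might pick, let [r_s]
  be the residual just before the index [s] is picked. Then the sum of
  [<Z_s, r_s> ^ 2] over the picks [s] outside the support of [beta] is at most
  [(O(tau) S) ^ 2].

In the second bound [r_s] is a function of [y] and of the columns picked before
[s], and column [s] does not enter [y] because [beta_s = 0]. So each term is the
square of a sub-Gaussian variable given the past, of variance proxy
[O(S ^ 2 / n)], and the union bound over the [p ^ k] sequences costs the
[k log p] contained in [tau ^ 2]. As the bound holds for all sequences at once,
it covers every way of breaking ties.

The theorem is a deterministic consequence of these bounds ([mod_omp_error]).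
Let [I] be the final set, [J] the part of the support that [I] misses, and
[eps] the norm of [beta] on [J]. Since [I] and the support both have [k]
elements, the number of wrong picks is [#|J|]. At each wrong pick [s] the greedy
rule compares [s] with all of [J], so
[#|J| <Z_s, r_s> ^ 2 >= sum_(j in J) <Z_j, r_s> ^ 2 >= (q eps - O(tau S)) ^ 2],
the last step by restricted isometry, unless [q eps] is already below the error
term. Summing over the [#|J|] wrong picks cancels
[#|J|] and gives [q eps = O(tau S)] ([missed_energy]): a run may select wrong
columns, but what it misses has small energy. On [I], the corrected Gram matrix
is within [O(tau / q ^ 2)] of the identity, which bounds the error of the final
estimate there ([estimate_on_support]).

All the probabilistic bounds come from one exponential supermartingale
inequality ([integral_exp_past_le1]): independent variables [V_i] are revealed
one after the other, and the coefficients of [V_i] may depend on everything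
revealed earlier. To put [<Z u, Z v>] in this form, the columns of [X] are
revealed in increasing order; besides a diagonal, which is a sum of independent
squares, there remain two triangular sums in which column [j] is multiplied by
the partial sum of the columns before it ([chaos]). The norms of these partial
sums are controlled by the same inequality, by induction on the number of
columns ([partial_sum_norm_le]). Suprema over sparse vectors are reduced to a
grid with [p ^ O(k)] points ([net_vec_dual]), which again costs only [k log p]. *)

(** * Independence from the past *)

(** The law of [(C, D)] is the product of the marginals, since measures on a
product are determined by rectangles; Tonelli does the rest. *)
Lemma integral_indep_pair d d1 d2 (T : measurableType d) (T1 : measurableType d1)
    (T2 : measurableType d2) (R : realType) (P : probability T R)
    (C : T -> T1) (D : {mfun T >-> T2}) (F : T1 * T2 -> \bar R) :
  measurable_fun setT C ->
  (forall A B, measurable A -> measurable B ->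
     P (C @^-1` A `&` D @^-1` B) = (P (C @^-1` A) * P (D @^-1` B))%E) ->
  measurable_fun setT F -> (forall x, (0 <= F x)%E) ->
  (\int[P]_w F (C w, D w) = \int[P]_w \int[P]_w' F (C w, D w'))%E.
Proof.
move=> mC indCD mF F0.
pose C' : {mfun T >-> T1} := HB.pack C (isMeasurableFun.Build _ _ _ _ _ mC).
have mpair : measurable_fun setT (fun w => (C w, D w)) by apply: measurable_fun_pair.
pose CD : {mfun T >-> (T1 * T2)%type} :=
  HB.pack (fun w => (C w, D w)) (isMeasurableFun.Build _ _ _ _ _ mpair).
transitivity (\int[distribution P CD]_x F x)%E.
  by rewrite ge0_integral_distribution.
rewrite (eq_measure_integral (distribution P C' \x distribution P D)%E); last first.
  move=> A mA _; apply/esym; exact: product_measure_unique.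
rewrite fubini_tonelli1// ge0_integral_distribution//=; last first.
- by move=> y; apply: integral_ge0 => *.
- exact: measurable_fun_fubini_tonelli_F.
apply: eq_integral => w _; rewrite /fubini_F /= ge0_integral_distribution//.
exact: measurableT_comp.
Qed.

Lemma measurable_integral_pair d d1 d2 (T : measurableType d) (T1 : measurableType d1)
    (T2 : measurableType d2) (R : realType) (P : probability T R)
    (C : T -> T1) (D : {mfun T >-> T2}) (F : T1 * T2 -> \bar R) :
  measurable_fun setT C -> measurable_fun setT F -> (forall x, (0 <= F x)%E) ->
  measurable_fun setT (fun w => \int[P]_w' F (C w, D w'))%E.
Proof.
move=> mC mF F0.
rewrite (_ : (fun w => _) = fubini_F (distribution P D) F \o C).
  by apply: measurableT_comp => //; exact: measurable_fun_fubini_tonelli_F.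
apply/funext => w; rewrite /fubini_F /= ge0_integral_distribution//.
exact: measurableT_comp.
Qed.

Section Past.
Context {d : measure_display} {T : measurableType d} {R : realType}.
Context {P : probability T R} {I : finType} (V : I -> {RV P >-> R}).

(** A pi-system that generates the sigma-algebra of the variables [V j], [j] in
[J]; mutual independence is a statement about these sets. *)
Definition boxes (J : {set I}) : set (set T) :=
  [set B | exists2 A : I -> set R, (forall i, measurable (A i)) &
     B = \bigcap_(i in [set` J]) V i @^-1` A i].

(** [T] with the coarser sigma-algebra of the variables [V j], [j] in [J].
Measurability on this type says that a function depends on these variables only,
without an explicit factorization through them. *)
Definition past (J : {set I}) := g_sigma_algebraType (boxes J).

HB.instance Definition _ J := Measurable.on (past J).

Lemma measurable_preimage_RV i (A : set R) : measurable A -> measurable (V i @^-1` A).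
Proof. by move=> mA; rewrite -[X in measurable X]setTI; exact: measurable_funP. Qed.

Lemma boxes_measurable J : boxes J `<=` d.-measurable.
Proof.
move=> _ [A mA ->]; apply: fin_bigcap_measurable; first exact: finite_finset.
by move=> i _; exact: measurable_preimage_RV.
Qed.

Lemma past_sub J : <<s boxes J >> `<=` d.-measurable.
Proof. by apply: smallest_sub; [exact: sigma_algebra_measurable|exact: boxes_measurable]. Qed.

Lemma boxes_mono (J J' : {set I}) : J \subset J' -> boxes J `<=` boxes J'.
Proof.
move=> /fintype.subsetP JJ' _ [A mA ->].
exists (fun i => if i \in J then A i else setT).
  by move=> i; case: ifP.
apply/seteqP; split=> w /= h i /= iJ.
  by case: ifPn => // iJ'; apply: h.
by have /(_ (JJ' _ iJ)) := h i; rewrite iJ.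
Qed.

Lemma past_mono d' (U : measurableType d') (J J' : {set I}) (f : T -> U) : J \subset J' ->
  measurable_fun setT (f : past J -> U) -> measurable_fun setT (f : past J' -> U).
Proof.
move=> JJ' mf _ Y mY; have := mf measurableT Y mY.
apply: sub_smallest2r; [exact: smallest_sigma_algebra|exact: boxes_mono].
Qed.

Lemma past_measurable d' (U : measurableType d') (J : {set I}) (f : T -> U) :
  measurable_fun setT (f : past J -> U) -> measurable_fun setT f.
Proof. by move=> mf _ Y mY; apply: past_sub (mf measurableT Y mY). Qed.

Lemma past_RV (J : {set I}) i : i \in J -> measurable_fun setT (V i : past J -> R).
Proof.
move=> iJ _ Y mY; rewrite setTI; apply: sub_sigma_algebra.
exists (fun j => if j == i then Y else setT); first by move=> j; case: ifP.
apply/seteqP; split=> w /= h; last by have /(_ iJ) := h i; rewrite eqxx.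
by move=> j /= _; case: eqP => // ->.
Qed.

Hypothesis indep : mutually_independent V.

(** Both sides are finite measures of [A] that agree on the pi-system [boxes J],
by mutual independence of the family indexed by [i |: J]. *)
Lemma indep_past (J : {set I}) i (A : set T) (B : set R) : i \notin J ->
  <<s boxes J >> A -> measurable B -> P (A `&` V i @^-1` B) = (P A * P (V i @^-1` B))%E.
Proof.
move=> iJ sA mB; have mVB := measurable_preimage_RV i mB.
have fVB : P (V i @^-1` B) \is a fin_num by apply: fin_num_measure.
have r0 : 0 <= fine (P (V i @^-1` B)) by apply: fine_ge0.
pose m2 := mscale (NngNum r0) P.
have m2E C : m2 C = (P C * P (V i @^-1` B))%E.
  by rewrite [RHS]muleC -[in RHS](fineK fVB).
suff : mrestr P mVB A = m2 A by move=> h; exact: (etrans h (m2E A)).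
apply: (@g_sigma_algebra_measure_unique _ _ _ (boxes J) (@boxes_measurable J) (fun=> setT)) => //.
- move=> _; exists (fun=> setT) => //; apply/seteqP; split=> //.
- by rewrite bigcup_const.
- move=> _ _ [A1 mA1 ->] [A2 mA2 ->]; exists (fun j => A1 j `&` A2 j).
    by move=> j; apply: measurableI.
  apply/seteqP; split=> w /=; first by move=> [h1 h2] j jJ; split; [apply: h1|apply: h2].
  by move=> h; split=> j jJ; have [] := h j jJ.
- move=> _ [A' mA' ->]; apply: (etrans _ (esym (m2E _))); rewrite /mrestr.
  have := indep (i |: J) (A := fun j => if j == i then B else A' j) _.
  rewrite big_setU1//= eqxx => /(_ _) h.
  transitivity (P (\bigcap_(i0 in [set` (i |: J)%SET])
      V i0 @^-1` (if i0 == i then B else A' i0))).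
    congr (P _); apply/seteqP; split=> w /=.
      move=> [h1 h2] j /=; rewrite in_setU1 => /orP[/eqP->|jJ]; first by rewrite eqxx.
      case: eqP => [->//|_]; exact: h1.
    move=> h1; split; last by have := h1 i; rewrite /= in_setU1 eqxx /= => /(_ isT).
    move=> j /= jJ; have := h1 j; rewrite /= in_setU1 jJ orbT => /(_ isT).
    by case: eqP => // ji; rewrite -ji jJ in iJ.
  rewrite h; last by move=> j; case: ifP.
  rewrite muleC; congr (_ * _)%E; rewrite (eq_bigr (fun j => P (V j @^-1` A' j))); last first.
    by move=> j jJ; case: eqP => // ji; rewrite -ji jJ in iJ.
  by rewrite -indep.
- move=> _; apply: (le_lt_trans (y := P setT)).
    by apply: le_measure; rewrite ?inE//=; apply: measurableI.
  by rewrite probability_setT ltry.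
Qed.

Lemma past_id_measurable J : measurable_fun setT (id : T -> past J).
Proof. by move=> _ Y mY; rewrite setTI; exact: (@past_sub J _ mY). Qed.

(** When [F] depends on its first argument through the past [J] only, the
variable [V i] can be replaced by an independent copy and integrated first. *)
Lemma indep_integral (J : {set I}) i (F : T -> R -> R) : i \notin J ->
  measurable_fun setT (fun x : past J * R => F x.1 x.2) -> (forall w v, 0 <= F w v) ->
  (\int[P]_w (F w (V i w))%:E = \int[P]_w \int[P]_w' (F w (V i w'))%:E)%E.
Proof.
move=> iJ mF F0; pose G (x : past J * R) := (F x.1 x.2)%:E.
apply: (@integral_indep_pair _ _ _ _ (past J) _ _ P id (V i) G).
- exact: past_id_measurable.
- by move=> A B mA mB; exact: (indep_past iJ mA mB).
- exact/measurable_EFinP.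
- by move=> x; rewrite lee_fin.
Qed.

Lemma measurable_integral_past (J : {set I}) i (F : T -> R -> R) :
  measurable_fun setT (fun x : past J * R => F x.1 x.2) -> (forall w v, 0 <= F w v) ->
  measurable_fun setT (fun w => \int[P]_w' (F w (V i w'))%:E)%E.
Proof.
move=> mF F0; pose G (x : past J * R) := (F x.1 x.2)%:E.
apply: (@measurable_integral_pair _ _ _ _ (past J) _ _ P id (V i) G).
- exact: past_id_measurable.
- exact/measurable_EFinP.
- by move=> x; rewrite lee_fin.
Qed.
End Past.

(** * The exponential supermartingale inequality *)

Lemma measurable_sum_cond d (T : measurableType d) (R : realType) (D : set T) (I : Type)
    (s : seq I) (Q : pred I) (h : I -> T -> R) :
  (forall i, Q i -> measurable_fun D (h i)) ->
  measurable_fun D (fun x => \sum_(i <- s | Q i) h i x).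
Proof.
move=> mh; pose h' i x := if Q i then h i x else 0.
rewrite (_ : (fun x => _) = (fun x => \sum_(i <- s) h' i x)); last first.
  by apply/funext => x; exact: big_mkcond.
by apply: measurable_sum => i; rewrite /h'; case Qi: (Q i); [exact: mh|exact: measurable_cst].
Qed.

Section Supermartingale.
Context {d : measure_display} {T : measurableType d} {R : realType}.
Context {P : probability T R} {I : finType} (V : I -> {RV P >-> R}).

(** The variables outside [S] count as revealed at the start; those in [S] are
revealed by increasing rank. *)
Definition earlier (S : {set I}) (rank : I -> nat) (i : I) : {set I} :=
  [set j | (j \notin S) || (rank j < rank i)%N].

Hypothesis indep : mutually_independent V.

(** The hypothesis on [c i], [e i] and [V i] says that, with the past frozen, the
conditional expectation of the factor of index [i] is at most 1. Remove an index
of maximal rank: none of the other factors depends on it, so integrating it out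
first by [indep_integral] leaves the same expression for a smaller [S]. *)
Lemma integral_exp_past_le1 (S : {set I}) (rank : I -> nat)
    (c e : I -> T -> R) (g : I -> R -> R) :
  (forall i, i \in S -> measurable_fun setT (c i : past V (earlier S rank i) -> R)) ->
  (forall i, i \in S -> measurable_fun setT (e i : past V (earlier S rank i) -> R)) ->
  (forall i, measurable_fun setT (g i)) ->
  (forall i, i \in S -> forall w,
    (\int[P]_w' (expR (c i w * g i (V i w') - e i w))%:E <= 1)%E) ->
  (\int[P]_w (expR (\sum_(i in S) (c i w * g i (V i w) - e i w)))%:E <= 1)%E.
Proof.
have [m] := ubnP #|S|; elim: m => // m IHm in S * => /ltnSE leSm mc me mg hle.
have [->|[i0 i0S]] := set_0Vmem S.
  under eq_integral do rewrite big_set0 expR0.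
  by rewrite integral_cst//= mul1e probability_le1.
have [i iS0 imax] := arg_maxnP rank i0S; have iS : i \in S := iS0.
pose S' := S :\ i.
have iNpast j : j \in S -> i \notin earlier S rank j.
  by move=> jS; rewrite inE negb_or negbK iS/= -leqNgt; exact: imax.
have mexp : measurable_fun setT ((fun w => expR (\sum_(j in S') (c j w * g j (V j w) - e j w)))
    : past V [set~ i]%SET -> R).
  apply: measurableT_comp => //; apply: measurable_sum_cond => j; rewrite !inE => /andP[ji jS].
  have sub : earlier S rank j \subset [set~ i]%SET.
    apply/fintype.subsetP => x xj; rewrite !inE; apply/negP => /eqP xi; by move: xj; rewrite xi (negPf (iNpast j jS)).
  apply: measurable_funB; last exact: past_mono sub (me _ jS).
  apply: measurable_funM; first exact: past_mono sub (mc _ jS).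
  apply: measurableT_comp => //; apply: past_RV; by rewrite !inE.
have sub : earlier S rank i \subset [set~ i]%SET.
  apply/fintype.subsetP => x xj; rewrite !inE; apply/negP => /eqP xi; by move: xj; rewrite xi (negPf (iNpast i iS)).
pose F w v := expR (\sum_(j in S') (c j w * g j (V j w) - e j w)) *
              expR (c i w * g i v - e i w).
have -> : (\int[P]_w (expR (\sum_(i in S) (c i w * g i (V i w) - e i w)))%:E =
          \int[P]_w (F w (V i w))%:E)%E.
  apply: eq_integral => w _; rewrite /F (big_setD1 i)//= addrC -expRD.
  by rewrite addrC.
have mF : measurable_fun setT (fun x : past V [set~ i]%SET * R => F x.1 x.2).
  apply: measurable_funM.
    by apply: (measurableT_comp mexp); exact: measurable_fst.
  apply: measurableT_comp => //; apply: measurable_funB.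
    apply: measurable_funM.
      by apply: (measurableT_comp (past_mono sub (mc _ iS))); exact: measurable_fst.
    by apply: measurableT_comp => //; exact: measurable_snd.
  by apply: (measurableT_comp (past_mono sub (me _ iS))); exact: measurable_fst.
have F0 w v : 0 <= F w v by rewrite mulr_ge0// expR_ge0.
rewrite (indep_integral indep _ mF F0); last by rewrite !inE eqxx.
have mg' w : measurable_fun setT (fun w' => expR (c i w * g i (V i w') - e i w)).
  apply: measurableT_comp => //; apply: measurable_funB => //; apply: measurable_funM => //.
  exact: measurableT_comp.
apply: (@le_trans _ _ (\int[P]_w (expR (\sum_(j in S') (c j w * g j (V j w) - e j w)))%:E)%E).
  apply: ge0_le_integral => //.
  - by move=> w _; apply: integral_ge0 => w' _; rewrite lee_fin mulr_ge0// expR_ge0.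
  - exact: measurable_integral_past mF F0.
  - by apply/measurable_EFinP; exact: past_measurable mexp.
  - move=> w _; rewrite /F; under eq_integral do rewrite EFinM.
    rewrite ge0_integralZl//.
    + rewrite -[leRHS]mule1 lee_pmul2l//; [exact: hle|by rewrite lte_fin expR_gt0].
    + by apply/measurable_EFinP.
apply: IHm => //.
- by apply: leq_trans leSm; rewrite [leqRHS](cardsD1 i) iS.
- move=> j; rewrite !inE => /andP[_ jS]; apply: past_mono (mc _ jS).
  apply/fintype.subsetP => x; rewrite !inE negb_and negbK.
  by case: (x \in S) => //=; rewrite ?orbT// => ->; rewrite orbT.
- move=> j; rewrite !inE => /andP[_ jS]; apply: past_mono (me _ jS).
  apply/fintype.subsetP => x; rewrite !inE negb_and negbK.
  by case: (x \in S) => //=; rewrite ?orbT// => ->; rewrite orbT.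
- by move=> j; rewrite !inE => /andP[_ jS]; exact: hle.
Qed.
End Supermartingale.

(** * Events of high probability *)

Section HighProbability.
Context {d : measure_display} {T : measurableType d} {R : realType}.
Variable P : probability T R.

Lemma high_probability_mono (q q' : R) (E E' : set T) : q' <= q -> E `<=` E' ->
  with_probability_at_least P q E -> with_probability_at_least P q' E'.
Proof.
move=> qq EE [A [mA AE qA]]; exists A; split=> //; first exact: subset_trans EE.
by apply: le_trans qA; rewrite lee_fin.
Qed.

Lemma high_probabilityI (x y : R) (E F : set T) :
  with_probability_at_least P (1 - x) E -> with_probability_at_least P (1 - y) F ->
  with_probability_at_least P (1 - (x + y)) (E `&` F).
Proof.
move=> [A [mA AE hA]] [B [mB BF hB]]; exists (A `&` B); split.
- exact: measurableI.
- exact: setISS.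
- have hAC : (P (~` A) <= x%:E)%E.
    rewrite probability_setC//; have fA : P A \is a fin_num by apply: fin_num_measure.
    by move: hA; rewrite -(fineK fA) -EFinB !lee_fin => ?; lra.
  have hBC : (P (~` B) <= y%:E)%E.
    rewrite probability_setC//; have fB : P B \is a fin_num by apply: fin_num_measure.
    by move: hB; rewrite -(fineK fB) -EFinB !lee_fin => ?; lra.
  have hU : (P (~` A `|` ~` B) <= (x + y)%:E)%E.
    apply: le_trans (measureU2 _ _ _) _; [exact: measurableC|exact: measurableC|].
    by rewrite EFinD; apply: leeD.
  rewrite -[A `&` B]setCK setCI probability_setC; last first.
    by apply: measurableU; apply: measurableC.
  have fU : P (~` A `|` ~` B) \is a fin_num.
    by apply: fin_num_measure; apply: measurableU; apply: measurableC.
  by move: hU; rewrite -(fineK fU) -EFinB !lee_fin => ?; lra.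
Qed.

(** Markov's inequality for the sum of the [expR (M x)], which is a union bound
over [F]. *)
Lemma high_probability_exp (F : finType) (M : F -> T -> R) (a : R) :
  (forall x, measurable_fun setT (M x)) ->
  (forall x, (\int[P]_w (expR (M x w))%:E <= 1)%E) ->
  with_probability_at_least P (1 - #|F|%:R * expR (- a)) [set w | forall x, M x w <= a].
Proof.
move=> mM hM.
pose Psi w := \sum_(x : F) expR (M x w).
have mPsi : measurable_fun setT Psi.
  by apply: measurable_sum => x; exact: measurableT_comp.
have Psi0 w : 0 <= Psi w by apply: sumr_ge0 => x _; exact: expR_ge0.
pose X : {RV P >-> R} := HB.pack Psi (isMeasurableFun.Build _ _ _ _ _ mPsi).
pose B := [set w | expR a <= Psi w].
have mB : measurable B.
  by rewrite -[X in measurable X]setTI; apply: measurable_fun_le => //; exact: measurable_cst.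
have hPsi : (\int[P]_w (Psi w)%:E <= #|F|%:R%:E)%E.
  rewrite /Psi; under eq_integral do rewrite -sumEFin.
  rewrite ge0_integral_sum//; last first.
    by move=> x; apply/measurable_EFinP; exact: measurableT_comp.
  apply: (@le_trans _ _ (\sum_(x : F) 1%:E)%E); first by apply: lee_sum => x _; exact: hM.
  by rewrite sumEFin sumr_const lee_fin.
have hB : (P B <= (#|F|%:R * expR (- a))%:E)%E.
  have := @markov _ _ _ P X id (expR a) (expR_gt0 a).
  move=> /(_ (@measurable_id _ _ _) (fun r h => h) (fun x y _ _ h => h)).
  rewrite unlock /=; under eq_integral do rewrite /= ger0_norm//.
  rewrite (_ : [set x | _] = B); last first.
    by apply/seteqP; split=> w /=; rewrite ger0_norm// lee_fin.
  move=> h; have := le_trans h hPsi.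
  have fB : P B \is a fin_num by apply: fin_num_measure.
  rewrite -(fineK fB) -EFinM !lee_fin expRN -[_ * _ <= _]ler_pdivlMl ?expR_gt0//.
  by rewrite mulrC.
exists (~` B); split.
- exact: measurableC.
- move=> w /= /negP; rewrite -ltNge => h x; rewrite -ler_expR.
  apply/ltW/(le_lt_trans _ h); rewrite /Psi (bigD1 x)//= lerDl.
  by apply: sumr_ge0 => y _; exact: expR_ge0.
- rewrite probability_setC//.
  have fB : P B \is a fin_num by apply: fin_num_measure.
  by move: hB; rewrite -(fineK fB) -EFinB !lee_fin => ?; lra.
Qed.
End HighProbability.

(** * Bounds on the exponential function *)

Section ExpBounds.
Context {R : realType}.
Implicit Types x y s : R.

(** For [x >= 0] the inequality [expR x (1 - x) <= 1] is used twice; for [x < 0]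
it gives [expR x <= (1 - x)^-1 <= 1 + x + x ^ 2]. *)
Lemma expR_le_quad x : expR x <= 1 + x + x ^+ 2 * expR `|x|.
Proof.
have [x0|x0] := leP 0 x.
  rewrite ger0_norm//.
  have h : expR x * (1 - x) <= 1.
    by rewrite -ler_pdivlMl ?expR_gt0// mulr1 -expRN; apply: expR_ge1Dx.
  have h1 : x * (expR x - 1) <= x * (x * expR x) by apply: ler_wpM2l => //; lra.
  by rewrite expr2; lra.
have h : expR x * (1 - x) <= 1.
  rewrite -ler_pdivlMl ?expR_gt0// mulr1 -expRN; exact: expR_ge1Dx.
have h1 : expR x <= 1 + x + x ^+ 2.
  have : expR x * (1 - x) <= (1 + x + x ^+ 2) * (1 - x).
    apply: le_trans h _; rewrite (_ : _ * _ = 1 - x ^+ 3); last by ring.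
    by rewrite lerBrDr -lerBrDl subrr exprSr pmulr_rle0 ?exprn_even_gt0//= ?ltW// lt_eqF.
  by rewrite ler_pM2r//; lra.
apply: le_trans h1 _; rewrite lerD2l ler_peMr ?sqr_ge0//.
by rewrite -expR0 ler_expR normr_ge0.
Qed.

Lemma expR_le_quad1 x : `|x| <= 1 -> expR x <= 1 + x + x ^+ 2 * expR 1.
Proof.
move=> x1; apply: le_trans (expR_le_quad x) _.
by rewrite lerD2l ler_wpM2l ?sqr_ge0// ler_expR.
Qed.

(** The factor [(x ^ 2 - 1) ^ 2] of the quadratic remainder is absorbed in an
exponential through [u ^ 2 / 2 <= expR u] at [u = |x ^ 2 - 1| / 16]. *)
Lemma expR_centered_square s x : `|s| <= 16^-1 ->
  expR (s * (x ^+ 2 - 1)) <=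
    1 + s * (x ^+ 2 - 1) + s ^+ 2 * (512 * expR (8^-1) * expR (x ^+ 2 / 8)).
Proof.
move=> s16; set y := x ^+ 2 - 1.
apply: le_trans (expR_le_quad _) _; rewrite lerD2l exprMn -[leLHS]mulrA.
apply: ler_wpM2l; first exact: sqr_ge0.
have hy : y ^+ 2 <= 512 * expR (`|y| / 16).
  have := @expR_ge1Dxn _ (`|y| / 16) 1 (divr_ge0 (normr_ge0 _) (ler0n _ _)).
  rewrite exprMn real_normK ?num_real// (_ : 2`!%:R = 2 :> R)// => h.
  have -> : y ^+ 2 = 512 * (y ^+ 2 * 16^-1 ^+ 2 / 2) by field.
  by apply: ler_wpM2l; [exact: ler0n|lra].
have hs : expR `|s * y| <= expR (`|y| / 16).
  by rewrite ler_expR normrM mulrC ler_wpM2l.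
apply: le_trans (ler_pM (sqr_ge0 _) (expR_ge0 _) hy hs) _.
rewrite -!mulrA; apply: ler_wpM2l; first exact: ler0n.
rewrite -!expRD ler_expR.
have : `|y| <= x ^+ 2 + 1 by rewrite (le_trans (ler_normB _ _))// normr1 ger0_norm ?sqr_ge0.
by lra.
Qed.

(** The exponent [m |x| - 2 m ^ 2] is maximal at [m = |x| / 4], with value
[x ^ 2 / 8]; rounding [m] down to an integer loses at most 2. *)
Lemma expR_square_le_cosh x : exists m : nat,
  expR (x ^+ 2 / 8) <= expR 2 * (expR (- 2 * m%:R ^+ 2) * (expR (m%:R * x) + expR (- m%:R * x))).
Proof.
have [m /andP[m1 m2]] : exists m : nat, m%:R <= `|x| / 4 < m.+1%:R.
  by exists (Num.truncn (`|x| / 4)); apply: truncn_itv; rewrite divr_ge0.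
exists m.
have h : expR (x ^+ 2 / 8) <= expR 2 * (expR (- 2 * m%:R ^+ 2) * expR (m%:R * `|x|)).
  rewrite -!expRD ler_expR -(real_normK (num_real x)).
  have {}m2 : `|x| / 4 < m%:R + 1 by rewrite natr1.
  set t := `|x| in m1 m2 *.
  have : (t / 4 - m%:R) ^+ 2 <= 1.
    by apply: exprn_ile1; lra.
  have -> : (t / 4 - m%:R) ^+ 2 = t ^+ 2 / 16 - t * m%:R / 2 + m%:R ^+ 2 by field.
  lra.
apply: le_trans h _; rewrite ler_wpM2l ?expR_ge0// ler_wpM2l ?expR_ge0//.
case: (ger0P x) => _; first by rewrite lerDl expR_ge0.
by rewrite mulrN -mulNr lerDr expR_ge0.
Qed.
End ExpBounds.

(** * Exponential moments of squares *)

Section ExpMoments.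
Context {d : measure_display} {T : measurableType d} {R : realType}.
Variable P : probability T R.

(** The linear term integrates to 0. To stay within integrals of nonnegative
functions, its negative part is moved to the other side. *)
Lemma integral_le_centered (H f Q : T -> R) (s h K : R) :
  measurable_fun setT H -> measurable_fun setT f -> measurable_fun setT Q ->
  (forall w, 0 <= H w) -> (forall w, 0 <= f w) -> (forall w, 0 <= Q w) ->
  (\int[P]_w (H w)%:E = h%:E)%E -> (\int[P]_w (Q w)%:E <= K%:E)%E ->
  (forall w, f w <= 1 + s * (H w - h) + Q w) ->
  (\int[P]_w (f w)%:E <= (1 + K)%:E)%E.
Proof.
move=> mH mf mQ H0 f0 Q0 intH intQ fle.
have h0 : 0 <= h by rewrite -lee_fin -intH; apply: integral_ge0 => w _; rewrite lee_fin.
have [a [b [a0 b0 sE]]] : exists a b, [/\ 0 <= a, 0 <= b & s = a - b].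
  by have [s0|s0] := leP 0 s; [exists s, 0|exists 0, (- s)]; split=> //; lra.
have H0E w : (0 <= (H w)%:E)%E by rewrite lee_fin.
have f0E w : (0 <= (f w)%:E)%E by rewrite lee_fin.
have Q0E w : (0 <= (Q w)%:E)%E by rewrite lee_fin.
have cstE (c : R) : (\int[P]_w c%:E = c%:E)%E.
  by rewrite integral_cst//= probability_setT mule1.
have intZ (c : R) : 0 <= c -> (\int[P]_w (c * H w)%:E = (c * h)%:E)%E.
  move=> c0; under eq_integral do rewrite EFinM.
  rewrite ge0_integralZl_EFin ?intH//; exact/measurable_EFinP.
have mZ (c : R) : measurable_fun setT (fun w => (c * H w)%:E).
  by apply/measurable_EFinP; apply: measurable_funM => //; exact: measurable_cst.
have intL : (\int[P]_w ((f w)%:E + ((a * h)%:E + (b * H w)%:E)) =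
    \int[P]_w (f w)%:E + (a * h + b * h)%:E)%E.
  rewrite ge0_integralD//.
  - rewrite ge0_integralD// ?cstE ?intZ//.
    + by move=> w _; rewrite lee_fin mulr_ge0.
    + by move=> w _; rewrite lee_fin mulr_ge0.
  - exact/measurable_EFinP.
  - by move=> w _; rewrite -EFinD lee_fin addr_ge0 ?mulr_ge0.
  - by apply: emeasurable_funD => //; exact: measurable_cst.
have intR : (\int[P]_w (((1 + b * h)%:E + (a * H w)%:E) + (Q w)%:E) <=
    (1 + b * h + a * h + K)%:E)%E.
  rewrite ge0_integralD//.
  - rewrite ge0_integralD// ?cstE ?intZ//.
    + by rewrite -EFinD [leRHS]EFinD; apply: leeD.
    + by move=> w _; rewrite lee_fin addr_ge0 ?mulr_ge0.
    + by move=> w _; rewrite lee_fin mulr_ge0.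
  - by move=> w _; rewrite -EFinD lee_fin !addr_ge0 ?mulr_ge0.
  - by apply: emeasurable_funD => //; exact: measurable_cst.
  - exact/measurable_EFinP.
have : (\int[P]_w (f w)%:E + (a * h + b * h)%:E <= (1 + b * h + a * h + K)%:E)%E.
  rewrite -intL; apply: le_trans intR; apply: ge0_le_integral => //.
  - by move=> w _; rewrite -!EFinD lee_fin !addr_ge0 ?mulr_ge0.
  - apply: emeasurable_funD; first exact/measurable_EFinP.
    by apply: emeasurable_funD => //; exact: measurable_cst.
  - apply: emeasurable_funD; last exact/measurable_EFinP.
    by apply: emeasurable_funD => //; exact: measurable_cst.
  - move=> w _; rewrite -!EFinD lee_fin; have := fle w; rewrite sE.
    by rewrite mulrBr !mulrBl; lra.
rewrite -leeBrDr// -EFinB => h'; apply: le_trans h' _; rewrite lee_fin; lra.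
Qed.

(** By [expR_square_le_cosh], [expR (W ^ 2 / 8)] is at most a series of values of
the moment generating function of [W] whose terms decay geometrically. *)
Lemma integral_exp_square_le (W : T -> R) : measurable_fun setT W ->
  (forall l, (\int[P]_w (expR (l * W w))%:E <= (expR (l ^+ 2 / 2))%:E)%E) ->
  (\int[P]_w (expR (W w ^+ 2 / 8))%:E <= (4 * expR 2)%:E)%E.
Proof.
move=> mW mgf.
have mexp (c : R) : measurable_fun setT (fun w => expR (c * W w)).
  by apply: measurableT_comp => //; apply: measurable_funM => //; exact: measurable_cst.
pose f (m : nat) w := expR 2 * (expR (- 2 * m%:R ^+ 2) *
  (expR (m%:R * W w) + expR (- m%:R * W w))).
have f0 m w : 0 <= f m w by rewrite !mulr_ge0 ?addr_ge0 ?expR_ge0.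
have mf m : measurable_fun setT (fun w => (f m w)%:E).
  apply/measurable_EFinP; do 2 (apply: measurable_funM; first exact: measurable_cst).
  exact: measurable_funD.
have intf m : (\int[P]_w (f m w)%:E <= (2 * expR 2 * 2^-1 ^+ m)%:E)%E.
  have c0 : 0 <= expR 2 * expR (- 2 * m%:R ^+ 2) :> R by rewrite mulr_ge0 ?expR_ge0.
  under eq_integral do rewrite /f mulrA EFinM EFinD.
  have g0 w : (0 <= (expR (m%:R * W w))%:E + (expR (- m%:R * W w))%:E)%E.
    by rewrite adde_ge0// lee_fin expR_ge0.
  have mexpE (c : R) : measurable_fun setT (fun w => (expR (c * W w))%:E).
    exact/measurable_EFinP.
  rewrite ge0_integralZl_EFin//; last exact: emeasurable_funD.
  rewrite ge0_integralD//.
  apply: (@le_trans _ _ ((expR 2 * expR (- 2 * m%:R ^+ 2))%:E *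
      (expR (m%:R ^+ 2 / 2) + expR (m%:R ^+ 2 / 2))%:E)%E).
    rewrite EFinD; apply: lee_wpmul2l; rewrite ?lee_fin//; apply: leeD => //.
    by apply: le_trans (mgf _) _; rewrite sqrrN.
  rewrite -EFinM lee_fin.
  rewrite [leLHS](_ : _ = 2 * expR 2 * (expR (- 2 * m%:R ^+ 2) * expR (m%:R ^+ 2 / 2)));
    last by ring.
  rewrite ler_wpM2l ?mulr_ge0 ?expR_ge0// -expRD.
  have e2 : expR (- 1) <= 2^-1 :> R.
    rewrite expRN lef_pV2 ?posrE ?expR_gt0//.
    by apply: le_trans (expR_ge1Dx 1); lra.
  apply: le_trans (lerXn2r m _ _ e2); rewrite ?nnegrE ?expR_ge0//.
  rewrite -expRM_natl ler_expR.
  have hm : (m%:R : R) <= m%:R ^+ 2 by rewrite -natrX ler_nat; nia.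
  have : 0 <= (m%:R : R) by []. 
  lra.
apply: (@le_trans _ _ (\int[P]_w \big[+%E/0%R]_(0 <= m <oo) (f m w)%:E)%E).
  apply: ge0_le_integral => //.
  - apply/measurable_EFinP; apply: measurableT_comp => //.
    by apply: measurable_funM => //; exact: measurable_funX.
  - by apply: ge0_emeasurable_sum => // m w _ _; rewrite lee_fin.
  - move=> w _; have [m hm] := expR_square_le_cosh (W w).
    apply: (@le_trans _ _ (\sum_(0 <= i < m.+1) (f i w)%:E)%E).
      rewrite big_nat_recr//= -[leLHS]add0e; apply: leeD; last by rewrite lee_fin.
      by apply: sume_ge0 => i _; rewrite lee_fin.
    by apply: nneseries_lim_ge => i _ _; rewrite lee_fin.
rewrite integral_nneseries//; last by move=> n w _; rewrite lee_fin.
apply: lime_le.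
  by apply: is_cvg_nneseries => n _ _; apply: integral_ge0 => w _; rewrite lee_fin.
apply: nearW => n; apply: (@le_trans _ _ (\sum_(0 <= i < n) (2 * expR 2 * 2^-1 ^+ i)%:E)%E).
  by apply: lee_sum.
rewrite sumEFin lee_fin -mulr_sumr (_ : 4 * expR 2 = 2 * expR 2 * 2 :> R); last by ring.
rewrite ler_wpM2l ?mulr_ge0 ?expR_ge0//.
suff -> : \sum_(0 <= i < n) 2^-1 ^+ i = 2 - 2 * 2^-1 ^+ n :> R.
  by rewrite lerBlDr lerDl mulr_ge0// exprn_ge0.
elim: n => [|n IH]; first by rewrite big_geq// expr0; lra.
by rewrite big_nat_recr//= IH exprS; lra.
Qed.

(** The constant of [expR_centered_square] times the bound [4 expR 2] of
[integral_exp_square_le]. *)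
Definition Ksq : R := 512 * expR 8^-1 * (4 * expR 2).

Lemma Ksq_ge0 : 0 <= Ksq.
Proof.
apply: mulr_ge0; last by rewrite mulr_ge0 ?expR_ge0.
by apply: mulr_ge0; [exact: ler0n|exact: expR_ge0].
Qed.

Lemma integral_exp_centered_square_le (W : T -> R) (s : R) : measurable_fun setT W ->
  (forall l, (\int[P]_w (expR (l * W w))%:E <= (expR (l ^+ 2 / 2))%:E)%E) ->
  (\int[P]_w (W w ^+ 2)%:E = 1)%E -> `|s| <= 16^-1 ->
  (\int[P]_w (expR (s * (W w ^+ 2 - 1)))%:E <= (1 + s ^+ 2 * Ksq)%:E)%E.
Proof.
move=> mW mgf W1 s16.
have mW2 : measurable_fun setT (fun w => W w ^+ 2) by exact: measurable_funX.
pose Q w := s ^+ 2 * (512 * expR 8^-1) * expR (W w ^+ 2 / 8).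
have mE : measurable_fun setT (fun w => expR (W w ^+ 2 / 8)).
  by apply: measurableT_comp => //; exact: measurable_funM.
have c0 : 0 <= s ^+ 2 * (512 * expR 8^-1).
  by apply: mulr_ge0; [exact: sqr_ge0|apply: mulr_ge0; [exact: ler0n|exact: expR_ge0]].
apply: (@integral_le_centered (fun w => W w ^+ 2) _ Q s 1) => //.
- apply: measurableT_comp => //; apply: measurable_funM => //; exact: measurable_funB.
- by apply: measurable_funM.
- by move=> w; exact: sqr_ge0.
- by move=> w; rewrite /Q mulr_ge0.
- under eq_integral do rewrite /Q EFinM.
  rewrite ge0_integralZl_EFin//; last by apply/measurable_EFinP.
  rewrite (_ : s ^+ 2 * Ksq = s ^+ 2 * (512 * expR 8^-1) * (4 * expR 2)); last by rewrite /Ksq mulrA.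
  rewrite [leRHS]EFinM; apply: lee_wpmul2l; rewrite ?lee_fin//.
  exact: integral_exp_square_le.
- by move=> w; rewrite /Q -mulrA; exact: expR_centered_square.
Qed.

End ExpMoments.

(** * Moments of the entries of the model *)

Section ModelMoments.
Context {d : measure_display} {T : measurableType d} {R : realType}.
Context {P : probability T R}.

Lemma integral_expB (f : T -> R) (c : R) : measurable_fun setT f ->
  (\int[P]_w (expR (f w))%:E <= (expR c)%:E)%E ->
  (\int[P]_w (expR (f w - c))%:E <= 1)%E.
Proof.
move=> mf hf.
under eq_integral do rewrite expRD mulrC EFinM.
rewrite ge0_integralZl_EFin ?expR_ge0//; last first.
  by apply/measurable_EFinP; exact: measurableT_comp.
apply: (@le_trans _ _ ((expR (- c))%:E * (expR c)%:E)%E).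
  by apply: lee_wpmul2l; rewrite ?lee_fin ?expR_ge0.
by rewrite -EFinM -expRD addNr expR0.
Qed.

Lemma sub_gaussian_mgf (s : R) (v : {RV P >-> R}) : sub_gaussian s v ->
  forall l, (\int[P]_w (expR (l * v w))%:E <= (expR (s ^+ 2 * l ^+ 2 / 2))%:E)%E.
Proof.
move=> [_ h] l; have := h l; rewrite /mmt_gen_fun unlock.
by under eq_integral do rewrite /= mulrC.
Qed.

Lemma sub_gaussian_exp_le1 (s : R) (v : {RV P >-> R}) : sub_gaussian s v ->
  forall c, (\int[P]_w (expR (c * v w - c ^+ 2 * s ^+ 2 / 2))%:E <= 1)%E.
Proof.
move=> h c; apply: (@integral_expB (fun w => c * v w)).
  by apply: measurable_funM.
by apply: le_trans (sub_gaussian_mgf h c) _; rewrite [c ^+ 2 * _]mulrC.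
Qed.

Lemma sub_gaussian_scaled_mgf (s t : R) (v : {RV P >-> R}) : sub_gaussian s v ->
  0 <= s -> 0 <= t -> s * t <= 1 ->
  forall l, (\int[P]_w (expR (l * (t * v w)))%:E <= (expR (l ^+ 2 / 2))%:E)%E.
Proof.
move=> h s0 t0 st l; under eq_integral do rewrite mulrA.
apply: le_trans (sub_gaussian_mgf h _) _; rewrite lee_fin ler_expR.
rewrite ler_pM2r// exprMn mulrCA -exprMn ler_piMr ?sqr_ge0//.
by rewrite exprn_ile1// mulr_ge0.
Qed.

Lemma zero_mean_variance (v : {RV P >-> R}) (x : R) : zero_mean v ->
  ('V_P[v] = x%:E -> \int[P]_w (v w ^+ 2)%:E = x%:E)%E.
Proof.
move=> v0; rewrite /variance covariance.unlock v0 /= expectation.unlock => <-.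
by apply: eq_integral => w _; rewrite /= !fctE /= subr0 -expr2.
Qed.

(** [integral_exp_centered_square_le] for [sqrt n v], which has variance 1. *)
Lemma square_sub_gaussian_exp_le1 (n : nat) (v : {RV P >-> R}) (s : R) : (0 < n)%N ->
  sub_gaussian (Num.sqrt n%:R)^-1 v -> 'V_P[v]%E = (n%:R^-1)%:E ->
  `|s| <= n%:R / 16 ->
  (\int[P]_w (expR (s * (v w ^+ 2 - n%:R^-1) - Ksq * s ^+ 2 / n%:R ^+ 2))%:E <= 1)%E.
Proof.
move=> n0 hv vv hs.
have nR0 : 0 < n%:R :> R by rewrite ltr0n.
set r := Num.sqrt (n%:R : R).
have r0 : 0 < r by rewrite sqrtr_gt0.
have r2 : r ^+ 2 = n%:R by rewrite sqr_sqrtr// ltW.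
have v2 := zero_mean_variance hv.1 vv.
have mv2 : measurable_fun setT (fun w => v w ^+ 2) by exact: measurable_funX.
apply: (@integral_expB (fun w => s * (v w ^+ 2 - n%:R^-1))).
  by apply: measurable_funM => //; exact: measurable_funB.
have hW : (\int[P]_w ((r * v w) ^+ 2)%:E = 1)%E.
  under eq_integral do rewrite exprMn r2 EFinM.
  rewrite ge0_integralZl_EFin//; last 2 first.
  - by move=> w _; rewrite lee_fin sqr_ge0.
  - exact/measurable_EFinP.
  by rewrite v2 -EFinM mulfV// gt_eqF.
have hs' : `|s / n%:R| <= 16^-1.
  by rewrite normrM normfV [`|n%:R|]gtr0_norm// ler_pdivrMr// mulrC.
have := @integral_exp_centered_square_le _ _ _ P (fun w => r * v w) (s / n%:R) _ _ hW hs'.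
have -> : (\int[P]_w (expR (s / n%:R * ((r * v w) ^+ 2 - 1)))%:E =
  \int[P]_w (expR (s * (v w ^+ 2 - n%:R^-1)))%:E)%E.
  apply: eq_integral => w _; congr (expR _)%:E; rewrite exprMn r2.
  by field; rewrite gt_eqF.
move=> h; apply: le_trans (h _ _) _.
- by apply: measurable_funM.
- apply: (sub_gaussian_scaled_mgf hv); [by rewrite invr_ge0 ltW|exact: ltW|].
  by rewrite mulVf// gt_eqF.
- rewrite lee_fin; apply: le_trans (expR_ge1Dx _) _; rewrite ler_expR.
  by rewrite expr_div_n mulrC mulrA.
Qed.

(** Chosen so that [4 expR 2 <= expR Kexp]. *)
Definition Kexp : R := 2 + 2.

(** The noise is normalized by [S], which is positive, rather than by its own
parameter [s], which may vanish. *)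
Lemma noise_square_exp_le1 (n : nat) (v : {RV P >-> R}) (s S : R) : (0 < n)%N ->
  0 <= s -> s <= S -> 0 < S -> sub_gaussian (s / Num.sqrt n%:R) v ->
  (\int[P]_w (expR (n%:R / (8 * S ^+ 2) * v w ^+ 2 - Kexp))%:E <= 1)%E.
Proof.
move=> n0 s0 sS S0 hv.
have nR0 : 0 < n%:R :> R by rewrite ltr0n.
have r0 : 0 < Num.sqrt n%:R :> R by rewrite sqrtr_gt0.
have r2 : Num.sqrt n%:R ^+ 2 = n%:R :> R by rewrite sqr_sqrtr// ltW.
have mv2 : measurable_fun setT (fun w => v w ^+ 2) by exact: measurable_funX.
apply: (@integral_expB (fun w => n%:R / (8 * S ^+ 2) * v w ^+ 2)).
  by apply: measurable_funM.
have := @integral_exp_square_le _ _ _ P (fun w => Num.sqrt n%:R / S * v w) _ _.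
have -> : (\int[P]_w (expR ((Num.sqrt n%:R / S * v w) ^+ 2 / 8))%:E =
  \int[P]_w (expR (n%:R / (8 * S ^+ 2) * v w ^+ 2))%:E)%E.
  apply: eq_integral => w _; congr (expR _)%:E; rewrite !exprMn r2.
  by field; rewrite gt_eqF.
move=> h; apply: le_trans (h _ _) _.
- by apply: measurable_funM.
- apply: (sub_gaussian_scaled_mgf hv); [by rewrite divr_ge0// ltW|by rewrite divr_ge0// ltW|].
  have -> : s / Num.sqrt n%:R * (Num.sqrt n%:R / S) = s / S.
    by field; rewrite !gt_eqF.
  by rewrite ler_pdivrMr ?mul1r.
- rewrite lee_fin /Kexp [leRHS]expRD ler_pM2r ?expR_gt0//.
  have e1 : 2 <= expR 1 :> R by apply: le_trans (expR_ge1Dx 1); lra.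
  have -> : expR 2 = expR 1 * expR 1 :> R by rewrite -expRD; congr expR; lra.
  have := ler_pM _ _ e1 e1; lra.
Qed.

Lemma bernoulli_exp_le1 (rho s : R) (v : {RV P >-> R}) : 0 <= rho <= 1 ->
  P (v @^-1` [set 1]) = (1 - rho)%:E -> (forall w, v w = 0 \/ v w = 1) ->
  `|s| <= 1 ->
  (\int[P]_w (expR (s * (v w - (1 - rho)) - s ^+ 2 * expR 1))%:E <= 1)%E.
Proof.
move=> /andP[rho0 rho1] v1 v01 s1.
apply: (@integral_expB (fun w => s * (v w - (1 - rho)))).
  by apply: measurable_funM => //; exact: measurable_funB.
have intv : (\int[P]_w (v w)%:E = (1 - rho)%:E)%E.
  have mB : measurable (v @^-1` [set 1]).
    by rewrite -[X in measurable X]setTI; exact: measurable_funP.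
  rewrite -v1 -[v @^-1` _]setIT -integral_indic//.
  apply: eq_integral => w _; congr EFin; rewrite indicE.
  case: (v01 w) => vw; rewrite vw; first by rewrite memNset//= vw => /eqP; rewrite eq_sym oner_eq0.
  by rewrite mem_set.
have := @integral_le_centered _ _ _ P v (fun w => expR (s * (v w - (1 - rho))))
  (fun=> s ^+ 2 * expR 1) s (1 - rho) (s ^+ 2 * expR 1).
move=> h; apply: (le_trans (h _ _ _ _ _ _ _ _ _)) => //.
- by apply: measurableT_comp => //; apply: measurable_funM => //; exact: measurable_funB.
- by move=> w; case: (v01 w) => ->.
- by move=> w; rewrite mulr_ge0 ?sqr_ge0 ?expR_ge0.
- by rewrite integral_cst//= probability_setT mule1.
- clear h => w; have vq : `|v w - (1 - rho)| <= 1.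
    by case: (v01 w) => ->; rewrite ler_norml; apply/andP; split; lra.
  have sv : `|s * (v w - (1 - rho))| <= `|s| by rewrite normrM ler_piMr.
  apply: le_trans (expR_le_quad1 (le_trans sv s1)) _.
  by rewrite lerD2l ler_wpM2r ?expR_ge0// -real_normK ?num_real// -[leRHS]real_normK ?num_real// lerXn2r ?nnegrE.
- by rewrite lee_fin expR_ge1Dx.
Qed.
End ModelMoments.

(** * Euclidean geometry of column vectors *)

Section Euclidean.
Context {R : realType}.

Definition dot (m : nat) (u v : 'cV[R]_m) : R := \sum_i u i 0 * v i 0.

Definition supported_on (m : nat) (U : {set 'I_m}) (u : 'cV[R]_m) :=
  forall i, i \notin U -> u i 0 = 0.

Section Dot.
Context {m : nat}.
Implicit Types u v w : 'cV[R]_m.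

Lemma dotC u v : dot u v = dot v u.
Proof. by apply: eq_bigr => i _; rewrite mulrC. Qed.

Lemma dotDl u v w : dot (u + v) w = dot u w + dot v w.
Proof. by rewrite -big_split /=; apply: eq_bigr => i _; rewrite !mxE mulrDl. Qed.

Lemma dotNl u v : dot (- u) v = - dot u v.
Proof. by rewrite -sumrN; apply: eq_bigr => i _; rewrite !mxE mulNr. Qed.

Lemma dotZl c u v : dot (c *: u) v = c * dot u v.
Proof. by rewrite mulr_sumr; apply: eq_bigr => i _; rewrite !mxE mulrA. Qed.

Lemma dotDr u v w : dot u (v + w) = dot u v + dot u w.
Proof. by rewrite !(dotC u) dotDl. Qed.

Lemma dotNr u v : dot u (- v) = - dot u v.
Proof. by rewrite !(dotC u) dotNl. Qed.

Lemma dotBr u v w : dot u (v - w) = dot u v - dot u w.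
Proof. by rewrite dotDr dotNr. Qed.

Lemma dotBl u v w : dot (u - v) w = dot u w - dot v w.
Proof. by rewrite dotDl dotNl. Qed.

Lemma dotZr c u v : dot u (c *: v) = c * dot u v.
Proof. by rewrite !(dotC u) dotZl. Qed.

Lemma dot_sqr u : dot u u = \sum_i u i 0 ^+ 2.
Proof. by apply: eq_bigr => i _; rewrite expr2. Qed.

Lemma dot_ge0 u : 0 <= dot u u.
Proof. by rewrite dot_sqr sumr_ge0// => i _; exact: sqr_ge0. Qed.

Lemma l2normE u : l2norm u = Num.sqrt (dot u u).
Proof. by rewrite dot_sqr. Qed.

Lemma l2norm_ge0 u : 0 <= l2norm u.
Proof. exact: sqrtr_ge0. Qed.

Lemma l2norm_sqr u : l2norm u ^+ 2 = dot u u.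
Proof. by rewrite l2normE sqr_sqrtr// dot_ge0. Qed.

Lemma l2normN u : l2norm (- u) = l2norm u.
Proof. by rewrite !l2normE dotNl dotNr opprK. Qed.

Lemma dot_eq0 u : dot u u = 0 -> u = 0.
Proof.
rewrite dot_sqr => /eqP; rewrite psumr_eq0; last by move=> i _; exact: sqr_ge0.
move=> /allP h; apply/colP => i; rewrite mxE; apply/eqP.
by have := h i; rewrite mem_index_enum sqrf_eq0; exact.
Qed.

Lemma l2norm_eq0 u : l2norm u = 0 -> u = 0.
Proof. by move=> h; apply: dot_eq0; rewrite -l2norm_sqr h expr0n. Qed.

Lemma dot_le u v : dot u v <= l2norm u * l2norm v.
Proof.
have [u0|u0] := eqVneq (l2norm u) 0.
  rewrite (l2norm_eq0 u0) /dot big1; first by rewrite mulr_ge0// l2norm_ge0.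
  by move=> i _; rewrite mxE mul0r.
have [v0|v0] := eqVneq (l2norm v) 0.
  rewrite (l2norm_eq0 v0) /dot big1; first by rewrite mulr_ge0// l2norm_ge0.
  by move=> i _; rewrite [X in _ * X]mxE mulr0.
have up : 0 < l2norm u by rewrite lt_neqAle eq_sym u0 l2norm_ge0.
have vp : 0 < l2norm v by rewrite lt_neqAle eq_sym v0 l2norm_ge0.
have := dot_ge0 (l2norm v *: u - l2norm u *: v).
rewrite !(dotBl, dotBr, dotZl, dotZr) -!l2norm_sqr (dotC v u).
set a := l2norm u in up *; set b := l2norm v in vp *; set c := dot u v => h.
have h2 : 0 <= (2 * a * b) * (a * b - c) by lra.
by rewrite pmulr_rge0 ?subr_ge0 ?mulr_gt0// in h2.
Qed.

Lemma normr_dot_le u v : `|dot u v| <= l2norm u * l2norm v.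
Proof. by rewrite ler_norml lerNl -dotNl -{1}(l2normN u) !dot_le. Qed.

Lemma l2normD u v : l2norm (u + v) <= l2norm u + l2norm v.
Proof.
have h : 0 <= l2norm u + l2norm v by rewrite addr_ge0// l2norm_ge0.
rewrite -(@ler_pXn2r _ 2)// ?nnegrE ?l2norm_ge0// sqrrD !l2norm_sqr.
rewrite dotDl !dotDr (dotC v u); have := dot_le u v; lra.
Qed.

Lemma dot_le_orthogonal u v : dot u v = 0 -> dot u u <= dot (u + v) (u + v).
Proof.
by move=> uv; rewrite dotDl !dotDr (dotC v u) uv; have := dot_ge0 v; lra.
Qed.

Lemma sum_sqr_le_l2norm (A : {set 'I_m}) u : \sum_(i in A) u i 0 ^+ 2 <= l2norm u ^+ 2.
Proof.
rewrite l2norm_sqr dot_sqr [leRHS](bigID (mem A))/= lerDl.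
by apply: sumr_ge0 => i _; exact: sqr_ge0.
Qed.
End Dot.

Lemma dot_mulmx_trmx (m l : nat) (A : 'M[R]_(m, l)) u v :
  dot (A *m u) v = dot u (A^T *m v).
Proof.
rewrite /dot; under eq_bigr do rewrite mxE mulr_suml.
rewrite exchange_big /=; apply: eq_bigr => j _.
rewrite mxE mulr_sumr; apply: eq_bigr => i _; rewrite mxE; ring.
Qed.

Lemma correlationE (n p : nat) (Z : 'M[R]_(n, p)) (r : 'cV[R]_n) i :
  correlation Z r i = (Z^T *m r) i 0.
Proof. by rewrite /correlation !mxE; apply: eq_bigr => j _; rewrite !mxE. Qed.

Section ZeroExtend.
Context {p : nat} (I : {set 'I_p}).
Implicit Types a b : 'cV[R]_#|I|.

Definition restrict (v : 'cV[R]_p) : 'cV[R]_#|I| := \col_a v (enum_val a) 0.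

(** [restrict] and [zero_extend] are inverse isometries between ['cV_#|I|] and
the vectors supported on [I]. With them the matrices indexed by [I] are studied
as quadratic forms on ['cV_p]. *)
Lemma zero_extend_val a (x : 'I_#|I|) : zero_extend a (enum_val x) 0 = a x 0.
Proof.
rewrite mxE (big_pred1 x)// => y /=.
by apply/eqP/eqP => [|->//]; exact: enum_val_inj.
Qed.

Lemma zero_extend_supported a : supported_on I (zero_extend a).
Proof.
move=> i iI; rewrite mxE big1// => x /eqP xi.
by move: iI; rewrite -xi enum_valP.
Qed.

Lemma sum_enum_val (F : 'I_p -> R) :
  (forall i, i \notin I -> F i = 0) -> \sum_i F i = \sum_(a < #|I|) F (enum_val a).
Proof.
move=> F0; rewrite (bigID (mem I))/= [X in _ + X]big1 ?addr0//.
by rewrite big_enum_val.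
Qed.

Lemma dot_zero_extend a v : dot (zero_extend a) v = dot a (restrict v).
Proof.
rewrite /dot sum_enum_val; last by move=> i iI; rewrite zero_extend_supported// mul0r.
by apply: eq_bigr => x _; rewrite zero_extend_val mxE.
Qed.

Lemma restrict_zero_extend a : restrict (zero_extend a) = a.
Proof. by apply/colP => x; rewrite mxE zero_extend_val. Qed.

Lemma zero_extend_restrict v : supported_on I v -> zero_extend (restrict v) = v.
Proof.
move=> sv; apply/colP => i; have [iI|iI] := boolP (i \in I).
  by rewrite -(enum_rankK_in iI iI) zero_extend_val mxE.
by rewrite sv// zero_extend_supported.
Qed.

Lemma dot_zero_extend2 a b : dot (zero_extend a) (zero_extend b) = dot a b.
Proof. by rewrite dot_zero_extend restrict_zero_extend. Qed.

Lemma l2norm_zero_extend a : l2norm (zero_extend a) = l2norm a.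
Proof. by rewrite !l2normE dot_zero_extend2. Qed.

Lemma mul_cols (n : nat) (Z : 'M[R]_(n, p)) a : cols Z I *m a = Z *m zero_extend a.
Proof.
apply/colP => t; rewrite !mxE [RHS]sum_enum_val; last first.
  by move=> i iI; rewrite zero_extend_supported// mulr0.
by apply: eq_bigr => x _; rewrite zero_extend_val mxE.
Qed.

Lemma zero_extendB a b : zero_extend (a - b) = zero_extend a - zero_extend b.
Proof.
apply/colP => i; rewrite !mxE -sumrB; apply: eq_bigr => x _; by rewrite !mxE.
Qed.
End ZeroExtend.

Lemma supported_sub (p : nat) (U W : {set 'I_p}) (u : 'cV[R]_p) : U \subset W ->
  supported_on U u -> supported_on W u.
Proof.
move=> /fintype.subsetP UW su i iW; apply: su; apply: contra iW; exact: UW.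
Qed.
End Euclidean.

(** * Analysis of the runs under restricted isometry *)

Section Deterministic.
Context {R : realType} {n p : nat}.
Variables (Z : 'M[R]_(n, p)) (y : 'cV[R]_n) (beta : 'cV[R]_p).
Variables (q eta S : R) (k : nat).
Hypotheses (q_gt0 : 0 < q) (q_le1 : q <= 1) (S_ge0 : 0 <= S) (eta_ge0 : 0 <= eta).
Hypothesis eta_small : 4 * eta <= q ^+ 2.
Hypothesis beta_S : l2norm beta <= S.
Hypothesis card_supp : #|[set i : 'I_p | beta i 0 != 0]%SET| = k.
Hypothesis near_isometry : forall (U : {set 'I_p}) (u v : 'cV[R]_p), (#|U| <= 2 * k)%N ->
  supported_on U u -> supported_on U v ->
  `|dot (Z *m u) (Z *m v) - q * dot u v| <= eta * l2norm u * l2norm v.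
Hypothesis near_unbiased : forall (U : {set 'I_p}) (u : 'cV[R]_p), (#|U| <= 2 * k)%N ->
  supported_on U u ->
  `|dot (Z *m u) y - q * dot u beta| <= eta * S * l2norm u.

Definition run_set (s : seq 'I_p) : {set 'I_p} := [set x in s]%SET.

Hypothesis wrong_picks : forall s : k.-tuple 'I_p, uniq s ->
  \sum_(i < k | beta (tnth s i) 0 == 0)
    correlation Z (residual Z y (run_set (take i s))) (tnth s i) ^+ 2 <= (eta * S) ^+ 2.

Let eta_q : 4 * eta <= q.
Proof. by apply: le_trans eta_small _; rewrite expr2 ger_pMl. Qed.

(** The product over an empty index set vanishes, so the initial residual [y] is
an instance of [residual]. *)
Lemma residual_set0 : residual Z y finset.set0 = y.
Proof.
rewrite /residual -!mulmxA; set v := _ *m y; set G := invmx _ *m v.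
rewrite (_ : _ *m G = 0) ?subr0//; apply/colP => t; rewrite !mxE big1// => i _.
by exfalso; have := ltn_ord i; rewrite [X in (_ < X)%N]cards0.
Qed.

(** A run is determined by the sequence of its picks: the residual before pick
[i] is that of the set of the first [i] picks. *)
Lemma omp_state_seq (j : nat) (I : {set 'I_p}) (r : 'cV[R]_n) : omp_state Z y j I r ->
  exists s : seq 'I_p, [/\ size s = j, uniq s, I = run_set s, r = residual Z y I &
    forall x0 i a, (i < j)%N -> a \notin take i s ->
      `|correlation Z (residual Z y (run_set (take i s))) a| <=
      `|correlation Z (residual Z y (run_set (take i s))) (nth x0 s i)|].
Proof.
elim => [|{}j {}I {}r i0 _ [s [sj us IE rE hs]] i0I hi0].
  exists [::]; split=> //; rewrite ?residual_set0//; apply/finset.setP => x; rewrite !inE.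
have i0s : i0 \notin s by move: i0I; rewrite IE inE.
exists (rcons s i0); split.
- by rewrite size_rcons sj.
- by rewrite rcons_uniq us i0s.
- by rewrite IE; apply/finset.setP => x; rewrite !inE mem_rcons inE.
- by [].
- move=> x0 i a; rewrite ltnS leq_eqVlt => /orP[/eqP ->|ij].
    rewrite -cats1 take_cat sj ltnn subnn take0 cats0 nth_cat sj ltnn subnn /= => ais.
    by rewrite -IE -rE; apply: hi0; rewrite IE inE.
  rewrite -cats1 take_cat sj ij nth_cat sj ij; exact: hs.
Qed.

Lemma gram_quad (I : {set 'I_p}) (a b : 'cV[R]_#|I|) :
  dot a (gram Z I *m b) = dot (Z *m zero_extend a) (Z *m zero_extend b).
Proof.
by rewrite /gram -mulmxA -dot_mulmx_trmx !mul_cols.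
Qed.

Lemma isometry_lower (U : {set 'I_p}) (u : 'cV[R]_p) : (#|U| <= 2 * k)%N ->
  supported_on U u -> (q - eta) * l2norm u ^+ 2 <= l2norm (Z *m u) ^+ 2.
Proof.
move=> Uk su; have := near_isometry Uk su su.
rewrite ler_norml => /andP[h _]; rewrite l2norm_sqr l2norm_sqr.
move: h; rewrite -[_ * _ * l2norm u]mulrA -expr2 l2norm_sqr; lra.
Qed.

Lemma gram_unit (I : {set 'I_p}) : (#|I| <= 2 * k)%N -> gram Z I \in unitmx.
Proof.
move=> Ik; rewrite unitmxE unitfE -det_tr; apply/negP => /det0P [v v0 vG].
have := @isometry_lower I (zero_extend v^T) Ik (@zero_extend_supported _ _ _ _).
rewrite [l2norm (Z *m _) ^+ 2]l2norm_sqr -gram_quad.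
have -> : gram Z I *m v^T = 0 by rewrite -[gram Z I]trmxK -trmx_mul vG trmx0.
rewrite (_ : dot _ 0 = 0); last by rewrite /dot big1// => i _; rewrite [X in _ * X]mxE mulr0.
rewrite l2norm_zero_extend pmulr_rle0; last by have := q_gt0; have := eta_q; lra.
rewrite le_eqVlt ltNge sqr_ge0 orbF sqrf_eq0 => /eqP /l2norm_eq0 /(congr1 trmx).
by rewrite trmxK trmx0 => vE; rewrite vE eqxx in v0.
Qed.

(** The coefficients of the least-squares fit of [y] by the columns in [I]. *)
Definition ls_coef (I : {set 'I_p}) : 'cV[R]_p :=
  zero_extend (invmx (gram Z I) *m ((cols Z I)^T *m y)).

Lemma residualE (I : {set 'I_p}) : residual Z y I = y - Z *m ls_coef I.
Proof. by rewrite /residual /ls_coef -mul_cols !mulmxA. Qed.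

Lemma residual_orthogonal (I : {set 'I_p}) (u : 'cV[R]_p) : (#|I| <= 2 * k)%N ->
  supported_on I u -> dot (Z *m u) (residual Z y I) = 0.
Proof.
move=> Ik su; rewrite residualE dotBr -{2}(zero_extend_restrict su) /ls_coef -gram_quad.
rewrite mulKVmx ?gram_unit// -dot_mulmx_trmx mul_cols zero_extend_restrict//.
by rewrite subrr.
Qed.

Lemma residual_norm_le (I : {set 'I_p}) : (#|I| <= 2 * k)%N ->
  dot (residual Z y I) (residual Z y I) <= dot y y.
Proof.
move=> Ik; have h := residual_orthogonal Ik (@zero_extend_supported _ _ _ _ : supported_on I (ls_coef I)).
have -> : dot y y = dot (residual Z y I + Z *m ls_coef I) (residual Z y I + Z *m ls_coef I).
  by rewrite residualE subrK.
by apply: dot_le_orthogonal; rewrite dotC.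
Qed.

Lemma ls_coef_norm (I : {set 'I_p}) : (#|I| <= 2 * k)%N -> l2norm (ls_coef I) <= 4 * S.
Proof.
move=> Ik; set th := ls_coef I.
have sth : supported_on I th by exact: zero_extend_supported.
have h := residual_orthogonal Ik sth; rewrite residualE dotBr in h.
have h1 := isometry_lower Ik sth; rewrite [in leRHS]l2norm_sqr in h1.
have h2 := near_unbiased Ik sth; rewrite ler_norml in h2; case/andP: h2 => _ h2.
have h3 := dot_le th beta.
have h4 : l2norm th * l2norm beta <= l2norm th * S by rewrite ler_wpM2l ?l2norm_ge0.
have [t0|t0] := eqVneq (l2norm th) 0; first by rewrite t0 mulr_ge0.
have tp : 0 < l2norm th by rewrite lt_neqAle eq_sym t0 l2norm_ge0.
set t := l2norm th in h1 h2 h3 h4 tp *.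
have h5 : (q - eta) * t ^+ 2 <= (q + eta) * S * t.
  have : q * dot th beta <= q * (t * S) by rewrite ler_pM2l//; lra.
  lra.
have h6 : (q - eta) * t <= (q + eta) * S.
  by rewrite -(ler_pM2r tp) -mulrA -expr2.
have h7 : (q - eta) * t <= (q - eta) * (4 * S).
  apply: le_trans h6 _; rewrite mulrA ler_wpM2r//; have := eta_q; have := eta_ge0; lra.
by rewrite ler_pM2l// in h7; have := eta_q; have := eta_ge0; have := q_gt0; lra.
Qed.

(** The residual is [y - Z theta] with [theta] supported on [I]. The term
[<Z u, y>] is [q <u, beta>] up to an error; as [A] and [I] are disjoint, [u] and
[theta] are orthogonal, and [<Z u, Z theta>] is only an error. *)
Lemma residual_correlation (A I : {set 'I_p}) (u : 'cV[R]_p) :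
  (#|A| <= k)%N -> (#|I| <= k)%N -> (forall i, i \in A -> i \notin I) ->
  supported_on A u ->
  q * dot u beta - 5 * eta * S * l2norm u <= dot (Z *m u) (residual Z y I).
Proof.
move=> Ak Ik AI su; rewrite residualE dotBr.
have Uk : (#|A :|: I| <= 2 * k)%N.
  by rewrite (leq_trans (leq_card_setU _ _))// mul2n -addnn leq_add.
have I2k : (#|I| <= 2 * k)%N by apply: leq_trans Ik _; rewrite leq_pmull.
have sth : supported_on I (ls_coef I) by exact: zero_extend_supported.
have uth : dot u (ls_coef I) = 0.
  rewrite /dot big1// => i _; have [iA|iA] := boolP (i \in A); last by rewrite su ?mul0r.
  by rewrite sth ?mulr0// AI.
have h1 := near_unbiased (leq_trans Ak (leq_pmull _ (isT : 0 < 2)%N)) su.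
have h2 := near_isometry Uk (supported_sub (finset.subsetUl _ _) su)
  (supported_sub (finset.subsetUr _ _) sth).
rewrite uth mulr0 subr0 in h2.
have h3 := ls_coef_norm I2k.
have h4 : eta * l2norm u * l2norm (ls_coef I) <= eta * l2norm u * (4 * S).
  by rewrite ler_wpM2l// mulr_ge0// l2norm_ge0.
move: h1 h2; rewrite !ler_norml => /andP[h1 _] /andP[_ h2]; lra.
Qed.

(** The missed part [Jf] of the support has as many elements as there are wrong
picks. At each wrong pick the picked correlation exceeds those of all the
elements of [Jf], whose sum of squares is bounded below by
[residual_correlation] applied to [beta] restricted to [Jf]. *)
Lemma missed_energy (I : {set 'I_p}) (r : 'cV[R]_n) : omp_state Z y k I r ->
  q * Num.sqrt (\sum_(i | i \notin I) beta i 0 ^+ 2) <= 6 * eta * S.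
Proof.
case/omp_state_seq => s [sk us IE _ greedy].
pose Jf := [set i | beta i 0 != 0]%SET :\: I.
pose u : 'cV[R]_p := \col_i (if i \in I then 0 else beta i 0).
have uE i : u i 0 = if i \in I then 0 else beta i 0 by rewrite mxE.
have su : supported_on Jf u.
  move=> i; rewrite uE !inE negb_and negbK; case: ifP => //= _.
  by rewrite negbK => /eqP.
have -> : Num.sqrt (\sum_(i | i \notin I) beta i 0 ^+ 2) = l2norm u.
  rewrite /l2norm [in RHS](bigID (mem I))/= [X in _ = Num.sqrt (X + _)]big1 ?add0r; last first.
    by move=> i iI; rewrite uE iI expr0n.
  by congr Num.sqrt; apply: eq_bigr => i iI; rewrite uE (negPf iI).
have ub : dot u beta = l2norm u ^+ 2.
  rewrite l2norm_sqr dot_sqr; apply: eq_bigr => i _; rewrite uE.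
  by case: ifP => _; rewrite ?mul0r ?expr0n// expr2.
set ep := l2norm u; rewrite leNgt; apply/negP => big.
have ep0 : 0 <= ep by exact: l2norm_ge0.
have etaS0 : 0 <= eta * S by rewrite mulr_ge0.
have epp : 0 < ep.
  rewrite lt_neqAle ep0 eq_sym andbT; apply/eqP => epE; move: big; rewrite epE mulr0; lra.
have card_I : #|I| = k.
  by rewrite IE /run_set cardsE -sk; apply/card_uniqP.
have Jfk : (#|Jf| <= k)%N by rewrite -card_supp subset_leq_card// finset.subsetDl.
pose t : k.-tuple 'I_p := Tuple (introT eqP sk).
pose w := #|[set i : 'I_k | beta (tnth t i) 0 == 0]%SET|.
have card_Jf : #|Jf| = w.
  have h1 : #|I :\: [set i | beta i 0 != 0]%SET| = #|Jf|.
    apply/eqP; rewrite -(eqn_add2l #|I :&: [set i | beta i 0 != 0]%SET|) cardsID card_I.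
    by rewrite finset.setIC cardsID card_supp.
  rewrite -h1 /w -(card_imset _ (_ : injective (tnth t))); last by apply/tuple_uniqP.
  congr #|pred_of_set _|; apply/finset.setP => x; apply/idP/imsetP.
    rewrite !inE negbK IE inE => /andP[/eqP bx xs].
    have /tnthP [i xi] : x \in t by [].
    by exists i => //; rewrite inE -xi bx.
  case=> i; rewrite inE => /eqP bi ->; rewrite !inE bi eqxx IE inE.
  exact: mem_tnth.
pose c (i : 'I_k) := correlation Z (residual Z y (run_set (take i s))) (tnth t i).
have step (i : 'I_k) : (q * ep - 5 * eta * S) ^+ 2 <= w%:R * c i ^+ 2.
  set Ii := run_set (take i s); set ri := residual Z y Ii.
  have IiI : Ii \subset I.
    by apply/fintype.subsetP => x; rewrite IE !inE; exact: mem_take.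
  have Iik : (#|Ii| <= k)%N by rewrite -card_I subset_leq_card.
  have JI x : x \in Jf -> x \notin Ii.
    by rewrite inE => /andP[xI _]; apply: contra xI; move/fintype.subsetP: IiI; exact.
  have h := residual_correlation Jfk Iik JI su; rewrite ub -/ep -/ri in h.
  pose g : 'cV[R]_p := \col_x (if x \in Jf then (Z^T *m ri) x 0 else 0).
  have hg : dot (Z *m u) ri <= ep * l2norm g.
    rewrite dot_mulmx_trmx (_ : dot u _ = dot u g); first exact: dot_le.
    apply: eq_bigr => x _; rewrite [g x 0]mxE; case: ifP => // /negbT xJ.
    by rewrite su// !mul0r.
  have g2 : l2norm g ^+ 2 <= w%:R * c i ^+ 2.
    rewrite l2norm_sqr dot_sqr (bigID (mem Jf))/= [X in _ + X]big1 ?addr0; last first.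
      by move=> x xJ; rewrite mxE (negPf xJ) expr0n.
    apply: (@le_trans _ _ (\sum_(x in Jf) c i ^+ 2)).
      apply: ler_sum => x xJ; rewrite mxE xJ -correlationE.
      rewrite -[leLHS]real_normK ?num_real// -[leRHS]real_normK ?num_real//.
      rewrite lerXn2r ?nnegrE// /c (tnth_nth x); apply: greedy => //.
      by have := JI _ xJ; rewrite inE.
    by rewrite sumr_const card_Jf mulr_natl.
  have h8 : q * ep - 5 * eta * S <= l2norm g.
    rewrite -(ler_pM2l epp); apply: le_trans hg; apply: le_trans h; lra.
  apply: le_trans g2; rewrite lerXn2r ?nnegrE ?l2norm_ge0//; lra.
have Jf0 : (0 < w)%N.
  rewrite -card_Jf card_gt0; apply/eqP => J0.
  have : u = 0 by apply/colP => i; rewrite su ?mxE// J0 inE.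
  move=> uz; move: epp; rewrite /ep uz l2normE /dot big1 ?sqrtr0 ?ltxx// => i _.
  by rewrite mxE mul0r.
have : w%:R * (q * ep - 5 * eta * S) ^+ 2 <= w%:R * (eta * S) ^+ 2.
  apply: (@le_trans _ _ (w%:R * \sum_(i < k | beta (tnth t i) 0 == 0) c i ^+ 2)).
    rewrite mulr_sumr mulr_natl -sumr_const.
    rewrite (eq_bigl (fun i => beta (tnth t i) 0 == 0)); last by move=> i; rewrite inE.
    by apply: ler_sum => i _; exact: step.
  by rewrite ler_wpM2l//; exact: (wrong_picks (s := t)).
rewrite ler_pM2l ?ltr0n// => h.
have : q * ep - 5 * eta * S <= eta * S.
  by rewrite -(@ler_pXn2r _ 2)// nnegrE; lra.
lra.
Qed.

Variable rho : R.
Hypothesis rhoE : 1 - rho = q.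

(** The Gram matrix is [q] times the identity up to [eta]. Dividing it by
[q ^ 2] is the right correction off the diagonal; on the diagonal the difference
[q^-1 - (q ^ 2)^-1] of the weights restores the identity. *)
Lemma Sigma_hat_near_id (I : {set 'I_p}) (a b : 'cV[R]_#|I|) : (#|I| <= 2 * k)%N ->
  `|dot a (Sigma_hat Z rho I *m b) - dot a b| <= 2 * eta / q ^+ 2 * l2norm a * l2norm b.
Proof.
move=> Ik; set G := gram Z I; have q2 : 0 < q ^+ 2 by rewrite exprn_gt0.
pose f (x : 'I_#|I|) := (G x x - q) * (q^-1 - (q ^+ 2)^-1).
pose a' : 'cV[R]_#|I| := \col_x (f x * a x 0).
have fle x : `|f x| <= eta / q ^+ 2.
  pose e : 'cV[R]_#|I| := delta_mx x 0.
  have ee : dot e e = 1.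
    rewrite /dot (bigD1 x)//= big1 ?addr0 ?mxE ?eqxx ?mulr1// => i ix.
    by rewrite mxE (negPf ix) mul0r.
  have := near_isometry Ik (@zero_extend_supported _ _ I e) (@zero_extend_supported _ _ I e).
  rewrite -gram_quad dot_zero_extend2 !l2norm_zero_extend l2normE ee sqrtr1 !mulr1.
  have -> : dot e (G *m e) = G x x.
    rewrite /dot (bigD1 x)//= big1 ?addr0; last by move=> i ix; rewrite mxE (negPf ix) mul0r.
    rewrite [e x 0]mxE !eqxx mul1r mxE (bigD1 x)//= big1 ?addr0; last first.
      by move=> i ix; rewrite [X in _ * X]mxE (negPf ix) mulr0.
    by rewrite [e x 0]mxE !eqxx mulr1.
  move=> h; rewrite normrM; apply: ler_pM => //.
  have h1 : q^-1 <= (q ^+ 2)^-1.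
    by rewrite lef_pV2 ?posrE// expr2 ger_pMl.
  have h2 : 0 < q^-1 by rewrite invr_gt0.
  by rewrite ler_norml; apply/andP; split; lra.
have decomp : dot a (Sigma_hat Z rho I *m b) - dot a b =
    (q ^+ 2)^-1 * (dot a (G *m b) - q * dot a b) + dot a' b.
  have -> : dot a (Sigma_hat Z rho I *m b) = (q ^+ 2)^-1 * dot a (G *m b) +
      \sum_x a x 0 * b x 0 * (G x x * (q^-1 - (q ^+ 2)^-1)).
    rewrite -dotZr /dot -big_split /=; apply: eq_bigr => x _.
    rewrite -[_ * b x 0 * _]mulrA -mulrDr; congr (_ * _); rewrite !mxE.
    rewrite (bigD1 x)//= [in RHS](bigD1 x)//= mulrDr mulr_sumr -addrA [X in _ = _ + X]addrC addrA.
    congr (_ + _); first by rewrite !mxE eqxx rhoE; ring.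
    by apply: eq_bigr => z zx; rewrite !mxE eq_sym (negPf zx) rhoE; ring.
  have -> : dot a' b = \sum_x a x 0 * b x 0 * (G x x * (q^-1 - (q ^+ 2)^-1)) -
      (q * (q^-1 - (q ^+ 2)^-1)) * dot a b.
    rewrite mulr_sumr -sumrB; apply: eq_bigr => x _; rewrite mxE /f; ring.
  by field; rewrite gt_eqF.
have a'le : l2norm a' <= eta / q ^+ 2 * l2norm a.
  have c0 : 0 <= eta / q ^+ 2 by rewrite divr_ge0// ltW.
  have c1 : 0 <= eta / q ^+ 2 * l2norm a by rewrite mulr_ge0// l2norm_ge0.
  rewrite -(@ler_pXn2r _ 2)// ?nnegrE ?l2norm_ge0// exprMn !l2norm_sqr !dot_sqr.
  rewrite mulr_sumr; apply: ler_sum => x _; rewrite mxE exprMn ler_wpM2r ?sqr_ge0//.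
  by rewrite -[leLHS]real_normK ?num_real// lerXn2r ?nnegrE.
rewrite decomp; apply: le_trans (ler_normD _ _) _.
have h1 : `|(q ^+ 2)^-1 * (dot a (G *m b) - q * dot a b)| <= eta / q ^+ 2 * l2norm a * l2norm b.
  have := near_isometry Ik (@zero_extend_supported _ _ I a) (@zero_extend_supported _ _ I b).
  rewrite -gram_quad dot_zero_extend2 !l2norm_zero_extend => h.
  rewrite normrM gtr0_norm ?invr_gt0//.
  have -> : eta / q ^+ 2 * l2norm a * l2norm b = (q ^+ 2)^-1 * (eta * l2norm a * l2norm b).
    by ring.
  by rewrite ler_pM2l// invr_gt0.
have h2 : `|dot a' b| <= eta / q ^+ 2 * l2norm a * l2norm b.
  by apply: le_trans (normr_dot_le _ _) _; rewrite ler_wpM2r// l2norm_ge0.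
by lra.
Qed.

Lemma Sigma_hat_coercive (I : {set 'I_p}) (a : 'cV[R]_#|I|) : (#|I| <= 2 * k)%N ->
  l2norm a ^+ 2 / 2 <= dot a (Sigma_hat Z rho I *m a).
Proof.
move=> Ik; have := Sigma_hat_near_id a a Ik.
have h : 2 * eta / q ^+ 2 <= 2^-1 by rewrite ler_pdivrMr ?exprn_gt0//; have := eta_small; lra.
have h2 : 2 * eta / q ^+ 2 * l2norm a * l2norm a <= 2^-1 * l2norm a ^+ 2.
  by rewrite -mulrA -expr2 ler_wpM2r ?sqr_ge0.
rewrite ler_norml => /andP[h1 _]; move: h1; rewrite -l2norm_sqr; lra.
Qed.

Lemma Sigma_hat_unit (I : {set 'I_p}) : (#|I| <= 2 * k)%N -> Sigma_hat Z rho I \in unitmx.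
Proof.
move=> Ik; rewrite unitmxE unitfE -det_tr; apply/negP => /det0P [v v0 vG].
have := @Sigma_hat_coercive I v^T Ik.
have -> : Sigma_hat Z rho I *m v^T = 0.
  by rewrite -[Sigma_hat Z rho I]trmxK -trmx_mul vG trmx0.
rewrite (_ : dot _ 0 = 0); last by rewrite /dot big1// => i _; rewrite [X in _ * X]mxE mulr0.
rewrite pmulr_lle0 ?invr_gt0// le_eqVlt ltNge sqr_ge0 orbF sqrf_eq0.
move=> /eqP /l2norm_eq0 /(congr1 trmx).
by rewrite trmxK trmx0 => vE; rewrite vE eqxx in v0.
Qed.

(** [Sigma_hat] maps the error [b - beta_I] to [gamma_hat - Sigma_hat beta_I],
which is small because [gamma_hat] and [Sigma_hat beta_I] are both close to
[beta_I]; coercivity transfers the bound to the error. *)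
Lemma estimate_on_support (I : {set 'I_p}) : (#|I| <= 2 * k)%N ->
  l2norm (invmx (Sigma_hat Z rho I) *m gamma_hat Z y rho I - restrict I beta) <=
    2 * eta * S / q + 4 * eta * l2norm beta / q ^+ 2.
Proof.
move=> Ik; set b := invmx _ *m _; set bs := restrict I beta; set dl := b - bs.
have hb : Sigma_hat Z rho I *m b = gamma_hat Z y rho I.
  by rewrite mulKVmx// Sigma_hat_unit.
have co := Sigma_hat_coercive dl Ik.
have h1 := Sigma_hat_near_id dl bs Ik.
have h2 := near_unbiased Ik (@zero_extend_supported _ _ I dl).
rewrite l2norm_zero_extend dot_zero_extend -mul_cols dot_mulmx_trmx -/bs in h2.
have bsle : l2norm bs <= l2norm beta.
  rewrite -(@ler_pXn2r _ 2)// ?nnegrE ?l2norm_ge0//.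
  apply: le_trans (sum_sqr_le_l2norm I beta); rewrite big_enum_val l2norm_sqr dot_sqr.
  by apply: ler_sum => x _; rewrite mxE.
have q2 : 0 < q ^+ 2 by rewrite exprn_gt0.
have h3 : 2 * eta / q ^+ 2 * l2norm dl * l2norm bs <= 2 * eta / q ^+ 2 * l2norm dl * l2norm beta.
  by rewrite ler_wpM2l// mulr_ge0 ?l2norm_ge0// divr_ge0 ?mulr_ge0// ltW.
have hS : dot dl (Sigma_hat Z rho I *m dl) = dot dl (gamma_hat Z y rho I) -
    dot dl (Sigma_hat Z rho I *m bs).
  by rewrite mulmxBr hb dotBr.
have hg : q * (dot dl (gamma_hat Z y rho I) - dot dl bs) =
    dot dl ((cols Z I)^T *m y) - q * dot dl bs.
  by rewrite /gamma_hat rhoE dotZr mulrBr mulrA mulfV ?gt_eqF// mul1r.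
have h4 : dot dl (gamma_hat Z y rho I) - dot dl bs <= eta * S / q * l2norm dl.
  rewrite -(ler_pM2l q_gt0) hg; move: h2; rewrite ler_norml => /andP[_ h2].
  apply: le_trans h2 _; rewrite [leRHS]mulrA [q * _]mulrC mulfVK// gt_eqF//.
have h5 : l2norm dl ^+ 2 / 2 <= (eta * S / q + 2 * eta * l2norm beta / q ^+ 2) * l2norm dl.
  apply: le_trans co _; rewrite hS; move: h1; rewrite ler_norml => /andP[h1 _].
  have -> : (eta * S / q + 2 * eta * l2norm beta / q ^+ 2) * l2norm dl =
    eta * S / q * l2norm dl + 2 * eta / q ^+ 2 * l2norm dl * l2norm beta by ring.
  lra.
have [d0|d0] := eqVneq (l2norm dl) 0.
  by rewrite d0 addr_ge0// divr_ge0 ?mulr_ge0 ?l2norm_ge0// ltW.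
have dp : 0 < l2norm dl by rewrite lt_neqAle eq_sym d0 l2norm_ge0.
rewrite -(ler_pM2r dp) -expr2.
have -> : (2 * eta * S / q + 4 * eta * l2norm beta / q ^+ 2) * l2norm dl =
  2 * ((eta * S / q + 2 * eta * l2norm beta / q ^+ 2) * l2norm dl) by ring.
by move: h5; lra.
Qed.

(** The error splits into [b - beta] on the selected set and the missed part of
[beta]. *)
Theorem mod_omp_error :
  mod_omp_output_satisfies Z y rho k
    (fun b => l2norm (b - beta) <= 8 * eta * S / q + 4 * eta * l2norm beta / q ^+ 2).
Proof.
move=> I b [[r run] ->].
have Ik : (#|I| <= 2 * k)%N.
  have [s [sk us IE _ _]] := omp_state_seq run.
  by rewrite IE /run_set cardsE (leq_trans (card_size _))// sk leq_pmull.
split; [exact: gram_unit|exact: Sigma_hat_unit|].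
have hm := missed_energy run; have he := estimate_on_support Ik.
set bI := invmx _ *m _ in he *.
have -> : zero_extend bI - beta = zero_extend (bI - restrict I beta) +
    (zero_extend (restrict I beta) - beta) by rewrite zero_extendB addrA subrK.
apply: le_trans (l2normD _ _) _; rewrite l2norm_zero_extend.
have hN : l2norm (zero_extend (restrict I beta) - beta) =
    Num.sqrt (\sum_(i | i \notin I) beta i 0 ^+ 2).
  rewrite /l2norm [in LHS](bigID (mem I))/= big1 ?add0r; last first.
    move=> i iI; rewrite !mxE -[\sum_(_ < _ | _) _]/(_) .
    have := @zero_extend_val _ _ I (restrict I beta) (enum_rank_in iI i).
    by rewrite enum_rankK_in// mxE => ->; rewrite mxE enum_rankK_in// subrr expr0n.
  congr Num.sqrt; apply: eq_bigr => i iI; rewrite mxE.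
  by rewrite zero_extend_supported// mxE sub0r sqrrN.
rewrite hN; move: hm; rewrite mulrC -ler_pdivlMr// => hm.
have -> : 8 * eta * S / q + 4 * eta * l2norm beta / q ^+ 2 =
  (2 * eta * S / q + 4 * eta * l2norm beta / q ^+ 2) + 6 * eta * S / q by ring.
exact: lerD.
Qed.

End Deterministic.

(** * Nets of sparse vectors *)

Section Net.
Context {R : realType}.

(** The shift by [G] lets an ordinal code the multiples of [1 / G] in [[-1, 1]]. *)
Definition grid_val (G : nat) (x : 'I_(2 * G).+1) : R := (x%:R - G%:R) / G%:R.

(** Round the coordinates of [g / |g|] towards 0. With [G ^ 2 >= 4 #|F|], the
rounded unit vector still correlates with [g] to at least [|g| / 2]. *)
Lemma grid_round (F : finType) (G : nat) (g : F -> R) : (0 < G)%N -> (4 * #|F| <= G ^ 2)%N ->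
  exists c : F -> 'I_(2 * G).+1,
  [/\ \sum_f grid_val (c f) ^+ 2 <= 1,
      forall f, g f = 0 -> grid_val (c f) = 0 &
      Num.sqrt (\sum_f g f ^+ 2) <= 2 * \sum_f grid_val (c f) * g f].
Proof.
move=> G0 FG; have GR : 0 < G%:R :> R by rewrite ltr0n.
set N := Num.sqrt _.
have [N0|N0] := eqVneq N 0.
  exists (fun=> inord G).
  have z : grid_val (inord G : 'I_(2 * G).+1) = 0.
    by rewrite /grid_val inordK ?subrr ?mul0r// ltnS leq_pmull.
  split; [|by []|].
    by rewrite big1 ?ler01// => f _; rewrite z expr0n.
  by rewrite N0 big1 ?mulr0// => f _; rewrite z mul0r.
have NP : 0 < N by rewrite lt_neqAle eq_sym N0 sqrtr_ge0.
have N2 : N ^+ 2 = \sum_f g f ^+ 2.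
  by rewrite sqr_sqrtr// sumr_ge0// => f _; exact: sqr_ge0.
pose x f := g f / N.
have x2 : \sum_f x f ^+ 2 = 1.
  under eq_bigr do rewrite /x expr_div_n.
  by rewrite -mulr_suml -N2 mulfV// expf_neq0.
have x1 f : `|x f| <= 1.
  rewrite -(@ler_pXn2r _ 2)// ?nnegrE// real_normK ?num_real// expr1n -x2 (bigD1 f)//= lerDl.
  by apply: sumr_ge0 => i _; exact: sqr_ge0.
have [m hm] : exists m : F -> nat, forall f, (m f)%:R <= `|x f| * G%:R < (m f).+1%:R.
  exists (fun f => Num.truncn (`|x f| * G%:R)) => f.
  by apply: truncn_itv; rewrite mulr_ge0.
have mG f : (m f <= G)%N.
  rewrite -(ler_nat R); have /andP[h _] := hm f; apply: le_trans h _.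
  by rewrite ler_piMl.
pose c f : 'I_(2 * G).+1 := inord (if 0 <= x f then (G + m f)%N else (G - m f)%N).
have cval f : grid_val (c f) = (if 0 <= x f then (m f)%:R else - (m f)%:R) / G%:R.
  rewrite /grid_val /c inordK; last by case: ifP => _; have := mG f; lia.
  by case: ifP => _; rewrite ?natrD ?natrB//; congr (_ / _); ring.
have cx f : grid_val (c f) * x f = (m f)%:R / G%:R * `|x f|.
  by rewrite cval; case: (ger0P (x f)) => h; ring.
have mle f : (m f)%:R / G%:R <= `|x f|.
  by rewrite ler_pdivrMr//; have /andP[] := hm f.
have mge f : `|x f| - G%:R^-1 <= (m f)%:R / G%:R.
  have /andP[_ h] := hm f; rewrite ler_pdivlMr// mulrBl mulVf ?gt_eqF//.
  by move: h; rewrite -(natr1 (m f)); lra.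
exists c; split.
- apply: (@le_trans _ _ (\sum_f x f ^+ 2)); last by rewrite x2.
  apply: ler_sum => f _; rewrite -[leRHS]real_normK ?num_real//.
  have -> : grid_val (c f) ^+ 2 = ((m f)%:R / G%:R) ^+ 2.
    by rewrite cval; case: ifP => _; rewrite // mulNr sqrrN.
  by rewrite lerXn2r ?nnegrE// divr_ge0.
- move=> f gf; have xf : x f = 0 by rewrite /x gf mul0r.
  have := mle f; rewrite xf normr0 => h.
  have m0 : (m f)%:R / G%:R = 0 :> R by apply/eqP; rewrite eq_le h divr_ge0.
  by rewrite cval; case: ifP => _; rewrite // mulNr m0 oppr0.
- have -> : \sum_f grid_val (c f) * g f = N * \sum_f grid_val (c f) * x f.
    by rewrite mulr_sumr; apply: eq_bigr => f _; rewrite /x; field.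
  have Nge : 0 <= N by exact: ltW.
  rewrite mulrCA ler_peMr//.
  have : \sum_f (3 / 4 * x f ^+ 2 - G%:R^-1 ^+ 2) <= \sum_f grid_val (c f) * x f.
    (* |x| / G <= x ^ 2 / 4 + G ^- 2 *)
    apply: ler_sum => f _; rewrite cx -(real_normK (num_real (x f))).
    have h1 : (`|x f| - G%:R^-1) * `|x f| <= (m f)%:R / G%:R * `|x f| by rewrite ler_wpM2r.
    have h2 : 0 <= (`|x f| / 2 - G%:R^-1) ^+ 2 by exact: sqr_ge0.
    by apply: le_trans h1; move: h2; rewrite sqrrB; lra.
  rewrite sumrB -mulr_sumr x2 sumr_const -mulr_natr.
  have : G%:R^-1 ^+ 2 * #|F|%:R <= 4^-1 :> R.
    rewrite exprVn mulrC ler_pdivrMr ?exprn_gt0// -natrX.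
    have : (4 * #|F|)%:R <= (G ^ 2)%:R :> R by rewrite ler_nat.
    by rewrite natrM; lra.
  by lra.
Qed.

(** Codes of [K]-sparse grid vectors. They are sequences of positions, possibly
repeated, rather than supports, so that their number is the power
[(p (2 G + 1)) ^ K]. *)
Definition net_code (p K G : nat) := {ffun 'I_K -> 'I_p * 'I_(2 * G).+1}.

Definition net_raw p K G (c : net_code p K G) : 'cV[R]_p :=
  \col_j \sum_(m | (c m).1 == j) grid_val (c m).2.

(** Codes whose vector leaves the unit ball stand for 0. *)
Definition net_vec p K G (c : net_code p K G) : 'cV[R]_p :=
  if dot (net_raw c) (net_raw c) <= 1 then net_raw c else 0.

Lemma net_vec_norm p K G (c : net_code p K G) : dot (net_vec c) (net_vec c) <= 1.
Proof.
rewrite /net_vec; case: ifP => // _; rewrite /dot big1 ?ler01// => i _.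
by rewrite mxE mul0r.
Qed.

Lemma dot_net_raw p K G (c : net_code p K G) (g : 'cV[R]_p) :
  dot (net_raw c) g = \sum_m grid_val (c m).2 * g (c m).1 0.
Proof.
rewrite /dot [RHS](partition_big (fun m => (c m).1) xpredT)//=.
apply: eq_bigr => j _; rewrite mxE mulr_suml; apply: eq_bigr => m /eqP <- //.
Qed.

(** The code lists [U] in its first positions, with the values given by
[grid_round]; the remaining positions have value 0. *)
Lemma net_vec_dual p K G (U : {set 'I_p}) (g : 'cV[R]_p) :
  (0 < p)%N -> (0 < G)%N -> (4 * K <= G ^ 2)%N -> (#|U| <= K)%N ->
  exists c : net_code p K G, supported_on U (net_vec c) /\
    Num.sqrt (\sum_(j in U) g j 0 ^+ 2) <= 2 * dot (net_vec c) g.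
Proof.
move=> p0 G0 KG UK; pose x0 : 'I_p := Ordinal p0.
pose i (m : 'I_K) := nth x0 (enum U) m.
pose g' (m : 'I_K) := if (m < #|U|)%N then g (i m) 0 else 0.
have [|gam [gam1 gam0 gamg]] := @grid_round _ G g' G0; first by rewrite card_ord.
pose c : net_code p K G := [ffun m => (i m, gam m)].
have gz (m : 'I_K) : (#|U| <= m)%N -> grid_val (gam m) = 0.
  by move=> Um; apply: gam0; rewrite /g' ltnNge Um.
have szU : size (enum U) = #|U| by rewrite -cardE.
have rawi (m : 'I_K) : (m < #|U|)%N -> net_raw c (i m) 0 = grid_val (gam m).
  move=> mU; rewrite mxE (bigD1 m)/= ?ffunE//= big1 ?addr0// => m'.
  rewrite ffunE /= => /andP[/eqP im mm].
  have [m'U|] := ltnP m' #|U|; last exact: gz.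
  move/eqP: im; rewrite nth_uniq ?enum_uniq ?szU// => /eqP /val_inj im.
  by rewrite im eqxx in mm.
have raw1 : dot (net_raw c) (net_raw c) <= 1.
  rewrite dot_net_raw; apply: le_trans gam1; apply: ler_sum => m _.
  rewrite ffunE /=; have [mU|mU] := ltnP m #|U|; first by rewrite rawi// expr2.
  by rewrite gz// mul0r expr0n.
have vE : net_vec c = net_raw c by rewrite /net_vec raw1.
exists c; rewrite vE; split.
  move=> j jU; rewrite mxE big1// => m; rewrite ffunE /= => /eqP ij.
  have [mU|mU] := ltnP m #|U|; last exact: gz.
  by exfalso; move/negP: jU; apply; rewrite -ij -mem_enum mem_nth// szU.
have <- : \sum_m g' m ^+ 2 = \sum_(j in U) g j 0 ^+ 2.
  rewrite -[RHS]big_enum (big_nth x0) -cardE big_mkord.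
  rewrite (big_ord_widen _ (fun m => g (nth x0 (enum U) m) 0 ^+ 2) UK) [RHS]big_mkcond /=.
  by apply: eq_bigr => m _; rewrite /g'; case: ifP => // _; rewrite expr0n.
apply: le_trans gamg _; rewrite ler_wpM2l// dot_net_raw; apply: ler_sum => m _.
rewrite ffunE /= /g'; case: ltnP => // mU; by rewrite gz// !mul0r.
Qed.

Lemma supported_dot_le p (U : {set 'I_p}) (u g : 'cV[R]_p) : supported_on U u ->
  `|dot u g| <= l2norm u * Num.sqrt (\sum_(j in U) g j 0 ^+ 2).
Proof.
move=> su; pose h : 'cV[R]_p := \col_j (if j \in U then g j 0 else 0).
have -> : dot u g = dot u h.
  apply: eq_bigr => j _; rewrite [h j 0]mxE; case: ifPn => // jU.
  by rewrite su// !mul0r.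
have -> : Num.sqrt (\sum_(j in U) g j 0 ^+ 2) = l2norm h.
  rewrite /l2norm [in RHS](bigID (mem U))/= [X in _ + X]big1 ?addr0; last first.
    by move=> j jU; rewrite mxE (negPf jU) expr0n.
  by congr Num.sqrt; apply: eq_bigr => j jU; rewrite mxE jU.
exact: normr_dot_le.
Qed.

Lemma net_linear_bound p K G (U : {set 'I_p}) (u g : 'cV[R]_p) (tau : R) :
  (0 < p)%N -> (0 < G)%N -> (4 * K <= G ^ 2)%N -> (#|U| <= K)%N -> supported_on U u ->
  (forall c : net_code p K G, supported_on U (net_vec c) -> dot (net_vec c) g <= tau) ->
  `|dot u g| <= 2 * tau * l2norm u.
Proof.
move=> p0 G0 KG UK su h; apply: le_trans (supported_dot_le g su) _.
have [c [sc hc]] := net_vec_dual g p0 G0 KG UK.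
rewrite mulrC ler_wpM2r ?l2norm_ge0//; apply: le_trans hc _.
by rewrite ler_wpM2l//; exact: h.
Qed.

(** [net_linear_bound] in each of the two arguments; each use costs a factor 2. *)
Lemma net_bilinear_bound p K G (M : 'M[R]_p) (U : {set 'I_p}) (u v : 'cV[R]_p) (tau : R) :
  (0 < p)%N -> (0 < G)%N -> (4 * K <= G ^ 2)%N -> (#|U| <= K)%N ->
  supported_on U u -> supported_on U v ->
  (forall c c' : net_code p K G, `|dot (net_vec c) (M *m net_vec c')| <= tau) ->
  `|dot u (M *m v)| <= 4 * tau * l2norm u * l2norm v.
Proof.
move=> p0 G0 KG UK su sv h.
have -> : 4 * tau * l2norm u * l2norm v = 2 * (2 * tau * l2norm v) * l2norm u by ring.
apply: (net_linear_bound p0 G0 KG UK su) => c _.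
apply: le_trans (ler_norm _) _.
have -> : dot (net_vec c) (M *m v) = dot v (M^T *m net_vec c).
  by rewrite dotC dot_mulmx_trmx.
apply: (net_linear_bound p0 G0 KG UK sv) => c' _.
apply: le_trans (ler_norm _) _.
by rewrite -dot_mulmx_trmx dotC.
Qed.
End Net.

(** * Measurability of residuals *)

Section MeasurableMatrix.
Context {d : measure_display} {T : measurableType d} {R : realType}.

Definition mx_measurable (m l : nat) (M : T -> 'M[R]_(m, l)) :=
  forall i j, measurable_fun setT (fun w => M w i j).

(** Inversion is continuous away from 0, and the inverse of 0 is 0. *)
Lemma measurable_invr : measurable_fun setT (GRing.inv : R -> R).
Proof.
have -> : (GRing.inv : R -> R) = (fun x => if x == 0 then 0 else x^-1).
  by apply/funext => x; case: eqP => // ->; rewrite invr0.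
apply: measurable_fun_if => //.
- exact: measurable_fun_eqr.
- rewrite setTI (_ : _ @^-1` _ = [set x : R | x != 0]); last first.
    by apply/seteqP; split=> x /=; case: eqP.
  apply: open_continuous_measurable_fun; first exact: open_neq.
  by move=> x /set_mem /= x0; exact: inv_continuous.
Qed.

Lemma mx_measurable_mul m l r (A : T -> 'M[R]_(m, l)) (B : T -> 'M[R]_(l, r)) :
  mx_measurable A -> mx_measurable B -> mx_measurable (fun w => A w *m B w).
Proof.
move=> mA mB i j; under eq_fun do rewrite mxE.
by apply: measurable_sum => x; apply: measurable_funM.
Qed.

Lemma mx_measurable_tr m l (A : T -> 'M[R]_(m, l)) :
  mx_measurable A -> mx_measurable (fun w => (A w)^T).
Proof. by move=> mA i j; under eq_fun do rewrite mxE; exact: mA. Qed.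

Lemma mx_measurable_sub m l (A B : T -> 'M[R]_(m, l)) :
  mx_measurable A -> mx_measurable B -> mx_measurable (fun w => A w - B w).
Proof. by move=> mA mB i j; under eq_fun do rewrite !mxE; exact: measurable_funB. Qed.

Lemma measurable_det m (A : T -> 'M[R]_m) : mx_measurable A ->
  measurable_fun setT (fun w => \det (A w)).
Proof.
move=> mA; rewrite /determinant; apply: measurable_sum => s.
by apply: measurable_funM => //; apply: measurable_prod => i _; exact: mA.
Qed.

(** [invmx] is given by cofactors when the determinant is nonzero and is the
identity function otherwise; the determinant is a polynomial in the entries. *)
Lemma mx_measurable_inv m (A : T -> 'M[R]_m) :
  mx_measurable A -> mx_measurable (fun w => invmx (A w)).
Proof.
move=> mA i j.
have -> : (fun w => invmx (A w) i j) = (fun w => if \det (A w) == 0 then A w i j else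
    (\det (A w))^-1 * ((-1) ^+ (j + i) * \det (row' j (col' i (A w))))).
  apply/funext => w; rewrite /invmx unitmxE unitfE; case: eqP => //= _.
  by rewrite !mxE.
have mdet := measurable_det mA.
apply: measurable_fun_ifT.
- exact: measurable_fun_eqr.
- exact: mA.
- apply: measurable_funM; first exact: (measurableT_comp measurable_invr).
  apply: measurable_funM => //; apply: measurable_det => x z.
  by under eq_fun do rewrite !mxE; exact: mA.
Qed.

Lemma mx_measurable_residual (n p : nat) (Z : T -> 'M[R]_(n, p)) (y : T -> 'cV[R]_n)
    (I : {set 'I_p}) :
  (forall i j, j \in I -> measurable_fun setT (fun w => Z w i j)) -> mx_measurable y ->
  mx_measurable (fun w => residual (Z w) (y w) I).
Proof.
move=> mZ my.
have mC : mx_measurable (fun w => cols (Z w) I).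
  by move=> i j; under eq_fun do rewrite mxE; apply: mZ; exact: enum_valP.
have mCt := mx_measurable_tr mC.
apply: mx_measurable_sub => //; do 2 (apply: mx_measurable_mul => //).
apply: mx_measurable_mul => //; apply: mx_measurable_inv; exact: mx_measurable_mul.
Qed.
End MeasurableMatrix.

(** * Column norms and noise norm *)

Section Events.
Context {d : measure_display} {T : measurableType d} {R : realType}.
Context {P : probability T R} {n p : nat}.
Variables (X : 'I_n -> 'I_p -> {RV P >-> R}) (e : 'I_n -> {RV P >-> R}).
Variable B : 'I_n -> 'I_p -> {RV P >-> R}.

Definition entry_index := ('I_n * 'I_p + 'I_n + 'I_n * 'I_p)%type.

Let V : entry_index -> {RV P >-> R} := masked_entries X e B.

Definition design_index (x : 'I_n * 'I_p) : entry_index := inl (inl x).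

Definition design_set (A : {set 'I_n * 'I_p}) : {set entry_index} :=
  [set design_index x | x in A]%SET.

(** The rank depends on the column alone: the entries of a column are revealed
simultaneously. *)
Definition column_rank (rk : 'I_p -> nat) (i : entry_index) : nat :=
  if i is inl (inl x) then rk x.2 else 0%N.

(** What is known when the entry [x] of the design is revealed: the noise, the
mask, the entries outside [A], and those in [A] of lower rank. *)
Definition before (A : {set 'I_n * 'I_p}) (rk : 'I_p -> nat) (x : 'I_n * 'I_p) :=
  past V (earlier (design_set A) (column_rank rk) (design_index x)).

Lemma design_index_inj : injective design_index.
Proof. by move=> x y [->]. Qed.

Lemma mem_design_set A x : (design_index x \in design_set A) = (x \in A).
Proof. by rewrite mem_imset//; exact: design_index_inj. Qed.

Lemma before_mask A rk x t j :
  measurable_fun setT (B t j : before A rk x -> R).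
Proof.
apply: (@past_RV _ _ _ _ _ V _ (inr (t, j))); rewrite inE.
by apply/orP; left; apply/imsetP => -[].
Qed.

Lemma before_noise A rk x t : measurable_fun setT (e t : before A rk x -> R).
Proof.
apply: (@past_RV _ _ _ _ _ V _ (inl (inr t))); rewrite inE.
by apply/orP; left; apply/imsetP => -[].
Qed.

Lemma before_design (A : {set 'I_n * 'I_p}) (rk : 'I_p -> nat) (x : 'I_n * 'I_p) t j :
  ((t, j) \notin A) || (rk j < rk x.2)%N ->
  measurable_fun setT (X t j : before A rk x -> R).
Proof.
move=> h; apply: (@past_RV _ _ _ _ _ V _ (design_index (t, j))).
by rewrite inE mem_design_set.
Qed.

Hypothesis indep : mutually_independent V.

Lemma high_probability_past (F : finType) (S : F -> {set entry_index})
    (rank : F -> entry_index -> nat) (c b : F -> entry_index -> T -> R) (g : R -> R) (a : R) :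
  (forall x i, i \in S x ->
     measurable_fun setT (c x i : past V (earlier (S x) (rank x) i) -> R)) ->
  (forall x i, i \in S x ->
     measurable_fun setT (b x i : past V (earlier (S x) (rank x) i) -> R)) ->
  measurable_fun setT g ->
  (forall x i, i \in S x -> forall w,
    (\int[P]_w' (expR (c x i w * g (V i w') - b x i w))%:E <= 1)%E) ->
  with_probability_at_least P (1 - #|F|%:R * expR (- a))
    [set w | forall x, \sum_(i in S x) (c x i w * g (V i w) - b x i w) <= a].
Proof.
move=> mc mb mg h.
apply: (@high_probability_exp _ _ _ P F
  (fun x w => \sum_(i in S x) (c x i w * g (V i w) - b x i w))).
- move=> x; apply: measurable_sum_cond => i iS; apply: measurable_funB.
    apply: measurable_funM; first exact: past_measurable (mc _ _ iS).
    exact: measurableT_comp.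
  exact: past_measurable (mb _ _ iS).
- move=> x; apply: (integral_exp_past_le1 indep (rank := rank x) (g := fun=> g)) => // i iS.
  + exact: mc.
  + exact: mb.
  + exact: h.
Qed.

Lemma high_probability_design (F : finType) (A : F -> {set 'I_n * 'I_p})
    (rk : F -> 'I_p -> nat) (c b : F -> 'I_n * 'I_p -> T -> R) (g : R -> R) (a : R) :
  (forall f x, x \in A f -> measurable_fun setT (c f x : before (A f) (rk f) x -> R)) ->
  (forall f x, x \in A f -> measurable_fun setT (b f x : before (A f) (rk f) x -> R)) ->
  measurable_fun setT g ->
  (forall f x, x \in A f -> forall w,
    (\int[P]_w' (expR (c f x w * g (X x.1 x.2 w') - b f x w))%:E <= 1)%E) ->
  with_probability_at_least P (1 - #|F|%:R * expR (- a))
    [set w | forall f, \sum_(x in A f) (c f x w * g (X x.1 x.2 w) - b f x w) <= a].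
Proof.
move=> mc mb mg h.
pose lift (c : F -> 'I_n * 'I_p -> T -> R) f (i : entry_index) :=
  if i is inl (inl x) then c f x else cst 0.
apply: high_probability_mono (lexx _) _ (@high_probability_past F
  (fun f => design_set (A f)) (fun f => column_rank (rk f)) (lift c) (lift b) g a _ _ mg _).
- move=> w /= hw f; have := hw f.
  by rewrite big_imset /=; last by move=> x y _ _; exact: design_index_inj.
- by move=> f i /imsetP[x xA ->]; exact: mc.
- by move=> f i /imsetP[x xA ->]; exact: mb.
- by move=> f i /imsetP[x xA ->]; exact: h.
Qed.

(** For a nonanticipating linear combination of entries of the design, the
compensator is half the sum of the conditional variance proxies. *)
Lemma high_probability_linear (F : finType) (A : F -> {set 'I_n * 'I_p})
    (rk : F -> 'I_p -> nat) (c : F -> 'I_n * 'I_p -> T -> R) (a : R) :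
  (forall i j, sub_gaussian (Num.sqrt n%:R)^-1 (X i j)) ->
  (forall f x, x \in A f -> measurable_fun setT (c f x : before (A f) (rk f) x -> R)) ->
  with_probability_at_least P (1 - #|F|%:R * expR (- a))
    [set w | forall f, \sum_(x in A f) (c f x w * X x.1 x.2 w) <=
       a + (2 * n%:R)^-1 * \sum_(x in A f) c f x w ^+ 2].
Proof.
move=> sX mc.
pose b f x w := c f x w ^+ 2 * (Num.sqrt n%:R)^-1 ^+ 2 / 2.
apply: high_probability_mono (lexx _) _ (@high_probability_design F A rk c b id a mc _ _ _).
- move=> w /= hw f; have := hw f; rewrite sumrB lerBlDr => /le_trans; apply.
  rewrite lerD2l mulr_sumr; apply: ler_sum => x _; rewrite /b exprVn sqr_sqrtr ?ler0n//.
  by rewrite invfM [leRHS]mulrC mulrA mulrAC.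
- move=> f x xA; do 2 (apply: measurable_funM => //).
  exact: measurable_funX (mc _ _ xA).
- exact: measurable_id.
- by move=> f x xA w; exact: sub_gaussian_exp_le1.
Qed.

Variables (rho sigma_e : R) (tau : R).
Hypothesis n_gt0 : (0 < n)%N.
Hypothesis rho01 : 0 <= rho < 1.
Hypothesis X_var : forall i j, 'V_P[X i j]%E = (n%:R^-1)%:E.
Hypothesis X_sub : forall i j, sub_gaussian (Num.sqrt n%:R)^-1 (X i j).
Hypothesis e_sub : forall i, sub_gaussian (sigma_e / Num.sqrt n%:R) (e i).
Hypothesis sigma_ge0 : 0 <= sigma_e.
Hypothesis B1 : forall i j, P (B i j @^-1` [set 1]) = (1 - rho)%:E.
Hypothesis B01 : forall i j w, B i j w = 0 \/ B i j w = 1.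
Hypotheses (tau_gt0 : 0 < tau) (tau_small : tau <= 16^-1).

(** The masked entries of [X] are those of [Z]; the flag allows [X] and [Z] to be
treated together. *)
Definition mask (f : bool) t j w : R := if f then B t j w else 1.

Lemma mask_bounds f t j w : 0 <= mask f t j w <= 1.
Proof. by rewrite /mask; case: f; rewrite ?ler01 ?lexx//; case: (B01 t j w) => ->; rewrite ?lexx ler01. Qed.

Lemma mask_sqr f t j w : mask f t j w ^+ 2 = mask f t j w.
Proof. by rewrite /mask; case: f; rewrite ?expr1n//; case: (B01 t j w) => ->; rewrite ?expr1n ?expr0n. Qed.

Let nR_gt0 : 0 < n%:R :> R. Proof. by rewrite ltr0n. Qed.

Lemma sum_column (F : 'I_n * 'I_p -> R) (j : 'I_p) :
  \sum_(x in [set x | x.2 == j]%SET) F x = \sum_t F (t, j).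
Proof.
rewrite (reindex_onto (fun t => (t, j)) fst) /=; last first.
  by case=> t l; rewrite inE /= => /eqP ->.
by apply: eq_bigl => t; rewrite inE !eqxx.
Qed.

(** The multiplier [n tau] balances the deviation [n tau ^ 2] with the variance
term; [tau <= 1 / 16] keeps it in the range of
[square_sub_gaussian_exp_le1]. *)
Lemma high_probability_columns :
  with_probability_at_least P (1 - (4 * p)%:R * expR (- (n%:R * tau ^+ 2)))
    [set w | forall f j,
      `|\sum_t mask f t j w * (X t j w ^+ 2 - n%:R^-1)| <= (1 + Ksq) * tau].
Proof.
pose F := ((bool * bool) * 'I_p)%type.
pose sg (b : bool) : R := if b then 1 else -1.
pose c (f : F) (x : 'I_n * 'I_p) w := sg f.1.1 * (n%:R * tau) * mask f.1.2 x.1 x.2 w.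
pose b (f : F) (x : 'I_n * 'I_p) (w : T) : R := Ksq * tau ^+ 2.
have cardF : #|{: F}| = (4 * p)%N by rewrite !card_prod card_bool card_ord.
rewrite -cardF.
apply: high_probability_mono (lexx _) _ (@high_probability_design F
  (fun f => [set x | x.2 == f.2]%SET) (fun=> fun=> 0%N) c b (fun v => v ^+ 2 - n%:R^-1) _ _ _ _ _).
- move=> w /= hw f j; rewrite ler_norml lerNl; apply/andP; split.
    have := hw ((false, f), j); rewrite sum_column /= sumrB sumr_const card_ord.
    rewrite -mulr_natr /c /=.
    under eq_bigr => t _ do rewrite -mulrA.
    rewrite -mulr_sumr; set M := \sum_t _ => h.
    have h2 : n%:R * tau * (- M) <= n%:R * tau * ((1 + Ksq) * tau) by move: h; rewrite /sg; lra.
    by rewrite ler_pM2l ?mulr_gt0// in h2.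
  have := hw ((true, f), j); rewrite sum_column /= sumrB sumr_const card_ord.
  rewrite -mulr_natr /c /=.
  under eq_bigr => t _ do rewrite -mulrA.
  rewrite -mulr_sumr; set M := \sum_t _ => h.
  have h2 : n%:R * tau * M <= n%:R * tau * ((1 + Ksq) * tau) by move: h; rewrite /sg; lra.
  by rewrite ler_pM2l ?mulr_gt0// in h2.
- move=> f x _; apply: measurable_funM => //; rewrite /mask; case: (f.1.2) => //.
  exact: before_mask.
- by move=> f x _; exact: measurable_cst.
- by apply: measurable_funB => //; exact: exprn_measurable.
- move=> f x _ w.
  have cn : `|c f x w| <= n%:R * tau.
    have /andP[m0 m1] := mask_bounds f.1.2 x.1 x.2 w.
    rewrite /c !normrM (_ : `|sg _| = 1) ?mul1r; last first.
      by rewrite /sg; case: ifP; rewrite ?normrN normr1.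
    rewrite !ger0_norm ?(ltW nR_gt0) ?(ltW tau_gt0)//.
    by rewrite ler_piMr// mulr_ge0// ltW.
  have cle : `|c f x w| <= n%:R / 16 by apply: le_trans cn _; rewrite ler_wpM2l.
  apply: le_trans (square_sub_gaussian_exp_le1 n_gt0 (X_sub x.1 x.2) (X_var x.1 x.2) cle).
  apply: ge0_le_integral => //.
  + apply/measurable_EFinP; apply: measurableT_comp => //; apply: measurable_funB => //.
    by apply: measurable_funM => //; apply: measurable_funB => //; exact: measurable_funX.
  + apply/measurable_EFinP; apply: measurableT_comp => //; apply: measurable_funB => //.
    by apply: measurable_funM => //; apply: measurable_funB => //; exact: measurable_funX.
  + move=> w' _; rewrite lee_fin ler_expR lerD2l lerN2 /b -mulrA.
    rewrite ler_wpM2l ?Ksq_ge0// ler_pdivrMr ?exprn_gt0// mulrC -exprMn.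
    by rewrite -[leLHS]real_normK ?num_real// lerXn2r ?nnegrE// mulr_ge0// ltW.
Qed.

Lemma high_probability_mask :
  with_probability_at_least P (1 - (2 * p)%:R * expR (- (n%:R * tau ^+ 2)))
    [set w | forall j,
      `|n%:R^-1 * \sum_t B t j w - (1 - rho)| <= (1 + expR 1) * tau].
Proof.
pose F := (bool * 'I_p)%type.
pose sg (b : bool) : R := if b then 1 else -1.
pose S (f : F) : {set entry_index} := [set inr (t, f.2) | t : 'I_n]%SET.
have cardF : #|{: F}| = (2 * p)%N by rewrite !card_prod card_bool card_ord.
rewrite -cardF.
apply: high_probability_mono (lexx _) _ (@high_probability_past F S
  (fun=> fun=> 0%N) (fun f _ _ => sg f.1 * tau) (fun _ _ _ => tau ^+ 2 * expR 1)
  (fun v => v - (1 - rho)) _ _ _ _ _).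
- move=> w /= hw j.
  have key b : n%:R * tau * (sg b * (n%:R^-1 * \sum_t B t j w - (1 - rho))) <=
      n%:R * tau * ((1 + expR 1) * tau).
    have := hw (b, j); rewrite /S big_imset /=; last by move=> t t' _ _ [].
    rewrite sumrB sumr_const -mulr_sumr sumrB sumr_const card_ord.
    rewrite -(mulr_natr (1 - rho) n) -(mulr_natr (tau ^+ 2 * expR 1) n).
    have -> : \sum_(t in 'I_n) B t j w = \sum_t B t j w by apply: eq_bigl => t; rewrite inE.
    set M := \sum_t _.
    have -> : n%:R * tau * (sg b * (n%:R^-1 * M - (1 - rho))) =
      sg b * tau * (M - (1 - rho) * n%:R) by field; rewrite gt_eqF.
    by lra.
  have ntau : 0 < n%:R * tau by rewrite mulr_gt0.
  rewrite ler_norml lerNl; apply/andP; split.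
    by have := key false; rewrite ler_pM2l// /sg mulN1r.
  by have := key true; rewrite ler_pM2l// /sg mul1r.
- by move=> f i _; exact: measurable_cst.
- by move=> f i _; exact: measurable_cst.
- by apply: measurable_funB.
- move=> f i /imsetP[t _ ->] w; rewrite -[V _]/(B t f.2).
  have -> : tau ^+ 2 = (sg f.1 * tau) ^+ 2.
    by rewrite exprMn /sg; case: ifP; rewrite ?sqrrN expr1n mul1r.
  apply: bernoulli_exp_le1 => //; first by case/andP: rho01 => -> /ltW ->.
  rewrite normrM (gtr0_norm tau_gt0) (_ : `|sg _| = 1) ?mul1r; last first.
    by rewrite /sg; case: ifP; rewrite ?normrN normr1.
  by apply: le_trans tau_small _; lra.
Qed.

Lemma high_probability_noise (S : R) : 0 < S -> sigma_e <= S ->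
  with_probability_at_least P (1 - expR (- (n%:R * tau ^+ 2)))
    [set w | \sum_t e t w ^+ 2 <= 40 * S ^+ 2].
Proof.
move=> S0 sS.
pose A : {set entry_index} := [set inl (inr t) | t : 'I_n]%SET.
have -> : expR (- (n%:R * tau ^+ 2)) = #|{: unit}|%:R * expR (- (n%:R * tau ^+ 2)).
  by rewrite card_unit mul1r.
apply: high_probability_mono (lexx _) _ (@high_probability_past unit (fun=> A)
  (fun=> fun=> 0%N) (fun _ _ _ => n%:R / (8 * S ^+ 2)) (fun _ _ _ => Kexp) (fun v => v ^+ 2) _ _ _ _ _).
- move=> w /= /(_ tt); rewrite /A big_imset /=; last by move=> t t' _ _ [].
  rewrite sumrB sumr_const card_ord -(mulr_natr Kexp n) -mulr_sumr.
  have -> : \sum_(t in 'I_n) e t w ^+ 2 = \sum_t e t w ^+ 2 by apply: eq_bigl => t; rewrite inE.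
  set M := \sum_t _.
  have -> : n%:R / (8 * S ^+ 2) * M = n%:R * (M / (8 * S ^+ 2)) by field; rewrite gt_eqF.
  rewrite lerBlDr [Kexp * _]mulrC -mulrDr ler_pM2l// ler_pdivrMr ?mulr_gt0 ?exprn_gt0// => h.
  have t2 : tau ^+ 2 <= 1 by apply: exprn_ile1; [exact: ltW|apply: le_trans tau_small _; lra].
  apply: le_trans h _; rewrite /Kexp.
  have S2 : 0 <= S ^+ 2 by exact: sqr_ge0.
  have := ler_wpM2r S2 t2; lra.
- by move=> f i _; exact: measurable_cst.
- by move=> f i _; exact: measurable_cst.
- exact: exprn_measurable.
- by move=> f i /imsetP[t _ ->] w; rewrite -[V _]/(e t); exact: (noise_square_exp_le1 n_gt0 sigma_ge0 sS S0).
Qed.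

End Events.

(** * Bilinear forms as triangular sums *)

Lemma sum_ord_ltnS (R : zmodType) (p m : nat) (mp : (m < p)%N) (F : 'I_p -> R) :
  \sum_(j < p | (j < m.+1)%N) F j = \sum_(j < p | (j < m)%N) F j + F (Ordinal mp).
Proof.
rewrite (bigD1 (Ordinal mp))//= addrC; congr (_ + _); apply: eq_bigl => j.
by rewrite ltnS (ltn_neqAle j m) andbC.
Qed.

Section Chaos.
Context {d : measure_display} {T : measurableType d} {R : realType}.
Context {P : probability T R} {n p : nat}.
Variables (X : 'I_n -> 'I_p -> {RV P >-> R}) (e : 'I_n -> {RV P >-> R}).
Variable B : 'I_n -> 'I_p -> {RV P >-> R}.
Variables (K G : nat) (beta : 'cV[R]_p) (S tau : R).

Hypothesis indep : mutually_independent (masked_entries X e B).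
Hypothesis n_gt0 : (0 < n)%N.
Hypothesis X_sub : forall i j, sub_gaussian (Num.sqrt n%:R)^-1 (X i j).
Hypothesis B01 : forall i j w, B i j w = 0 \/ B i j w = 1.
Hypotheses (tau_gt0 : 0 < tau) (tau_small : tau <= 16^-1).
Hypotheses (S_gt0 : 0 < S) (beta_S : l2norm beta <= S).

Let nR_gt0 : 0 < n%:R :> R. Proof. by rewrite ltr0n. Qed.

(** The bilinear forms to be controlled involve the vectors [Z u] for [u] in the
net and the normalized response [y / S]. Both are combinations of columns, plus
noise: [Some c] stands for [Z (net_vec c)] and [None] for [y / S]. *)
Definition direction := option (net_code p K G).

Definition dir_vec (o : direction) : 'cV[R]_p :=
  if o is Some c then net_vec c else S^-1 *: beta.

Definition dir_noise (o : direction) : R := if o then 0 else S^-1.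

Lemma dir_vec_norm o : dot (dir_vec o) (dir_vec o) <= 1.
Proof.
case: o => [c|]; first exact: net_vec_norm.
rewrite /dir_vec dotZl dotZr -l2norm_sqr mulrA -expr2 exprVn mulrC.
have S_ge0 := ltW S_gt0.
by rewrite ler_pdivrMr ?exprn_gt0// mul1r lerXn2r ?nnegrE ?l2norm_ge0.
Qed.

Lemma dir_noise_sqr o : dir_noise o ^+ 2 <= S ^- 2.
Proof. by case: o => [c|] /=; rewrite ?expr0n ?exprVn//= invr_ge0 sqr_ge0. Qed.

Let D (o : direction) t j w : R := mask B (isSome o) t j w.

Definition partial_sum (o : direction) (m : nat) t w : R :=
  dir_noise o * e t w +
  \sum_(l < p | (l < m)%N) dir_vec o l 0 * (D o t l w * X t l w).

(** The part of the inner product of two directions in which column [j] of the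
first one meets a column [l < j] of the second one, or its noise. *)
Definition chaos (o o' : direction) (m : nat) w : R :=
  \sum_(j < p | (j < m)%N) \sum_t
    dir_vec o j 0 * (D o t j w * X t j w) * partial_sum o' j t w.

(** Up to the factor [1 / n], a bound on the sum of the conditional variance
proxies in [chaos]. *)
Definition chaos_energy (o o' : direction) (m : nat) w : R :=
  \sum_(j < p | (j < m)%N) \sum_t dir_vec o j 0 ^+ 2 * partial_sum o' j t w ^+ 2.

Lemma sum_columns_before (m : nat) (F : 'I_n * 'I_p -> R) :
  \sum_(x in [set x : 'I_n * 'I_p | (x.2 < m)%N]%SET) F x =
  \sum_(j < p | (j < m)%N) \sum_t F (t, j).
Proof.
rewrite exchange_big pair_big_dep /=; apply: eq_big => [[t j]|[t j] _] //.
by rewrite inE.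
Qed.

Lemma before_partial_sum o (A : {set 'I_n * 'I_p}) x t :
  measurable_fun setT (partial_sum o x.2 t : before X e B A (fun j => val j) x -> R).
Proof.
apply: measurable_funD.
  by apply: measurable_funM => //; exact: before_noise.
apply: measurable_sum_cond => l lx; do 2 (apply: measurable_funM => //).
  by rewrite /D /mask; case: (isSome o) => //; exact: before_mask.
by apply: before_design; rewrite lx orbT.
Qed.

(** Two multipliers are needed: [n / 2] for the first, crude bound on the norms of
the partial sums, and [n tau] for the final bound on [chaos]. *)
Definition lam (b : bool) : R := if b then n%:R / 2 else n%:R * tau.

Lemma lam_gt0 b : 0 < lam b.
Proof. by case: b; rewrite /lam ?mulr_gt0. Qed.

Definition chaos_event w := forall o o' m b, (m <= p)%N ->
  `|chaos o o' m w| <= n%:R * tau ^+ 2 / lam b + lam b / (2 * n%:R) * chaos_energy o o' m w.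

(** [chaos] is linear in the entries of column [j] of [X] once the columns before
[j], the mask and the noise are known. *)
Lemma high_probability_chaos :
  with_probability_at_least P
    (1 - (((p * (2 * G).+1) ^ K).+1 ^ 2 * (4 * p.+1))%:R * expR (- (n%:R * tau ^+ 2)))
    [set w | chaos_event w].
Proof.
pose F := ((direction * direction) * ('I_p.+1 * (bool * bool)))%type.
pose sg (b : bool) : R := if b then 1 else -1.
pose c (f : F) (x : 'I_n * 'I_p) w := sg f.2.2.1 * lam f.2.2.2 * dir_vec f.1.1 x.2 0 *
  D f.1.1 x.1 x.2 w * partial_sum f.1.2 x.2 x.1 w.
have cardF : #|{: F}| = (((p * (2 * G).+1) ^ K).+1 ^ 2 * (4 * p.+1))%N.
  rewrite !card_prod card_bool card_ord card_option card_ffun card_prod !card_ord.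
  by rewrite (mulnC p.+1) expnS expn1.
rewrite -cardF.
apply: high_probability_mono (lexx _) _ (@high_probability_linear _ _ _ P n p X e B indep F
  (fun f => [set x : 'I_n * 'I_p | (x.2 < f.2.1)%N]%SET) (fun=> fun j => val j) c _ X_sub _).
- move=> w /= hw o o' m b mp.
  have key s : sg s * chaos o o' m w <=
      n%:R * tau ^+ 2 / lam b + lam b / (2 * n%:R) * chaos_energy o o' m w.
    have := hw ((o, o'), (inord m, (s, b))); rewrite /= inordK// !sum_columns_before /c /= => h.
    rewrite -(ler_pM2l (lam_gt0 b)).
    have l0 := lam_gt0 b.
    have -> : lam b * (sg s * chaos o o' m w) = \sum_(j < p | (j < m)%N) \sum_t
       sg s * lam b * dir_vec o j 0 * D o t j w * partial_sum o' j t w * X t j w.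
      rewrite !mulr_sumr; apply: eq_bigr => j _; rewrite !mulr_sumr.
      by apply: eq_bigr => t _; ring.
    apply: le_trans h _; rewrite mulrDr [lam b * (_ / _)]mulrC mulfVK ?gt_eqF// lerD2l.
    have -> : lam b * (lam b / (2 * n%:R) * chaos_energy o o' m w) =
      (2 * n%:R)^-1 * (lam b ^+ 2 * chaos_energy o o' m w) by ring.
    apply: ler_wpM2l; first by rewrite invr_ge0 mulr_ge0// ltW.
    rewrite mulr_sumr; apply: ler_sum => j _; rewrite mulr_sumr; apply: ler_sum => t _.
    have /andP[m0 m1] := mask_bounds B01 (isSome o) t j w.
    have -> : (sg s * lam b * dir_vec o j 0 * D o t j w * partial_sum o' j t w) ^+ 2 =
      D o t j w * (lam b ^+ 2 * (dir_vec o j 0 ^+ 2 * partial_sum o' j t w ^+ 2)).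
      rewrite !exprMn mask_sqr// (_ : sg s ^+ 2 = 1) ?mul1r; last first.
        by rewrite /sg; case: ifP; rewrite ?sqrrN expr1n.
      by rewrite /D; ring.
    rewrite ler_piMl//; apply: mulr_ge0; first exact: sqr_ge0.
    by apply: mulr_ge0; exact: sqr_ge0.
  rewrite ler_norml lerNl; apply/andP; split; last by have := key true; rewrite mul1r.
  by have := key false; rewrite mulN1r.
- move=> f x _; apply: measurable_funM; last exact: before_partial_sum.
  apply: measurable_funM => //.
  by rewrite /D /mask; case: (isSome _) => //; exact: before_mask.
Qed.

Variable w : T.

Lemma partial_sumS o m t (mp : (m < p)%N) : partial_sum o m.+1 t w =
  partial_sum o m t w +
  dir_vec o (Ordinal mp) 0 * (D o t (Ordinal mp) w * X t (Ordinal mp) w).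
Proof. by rewrite /partial_sum (sum_ord_ltnS mp) addrA. Qed.

Lemma chaosS o o' m (mp : (m < p)%N) : chaos o o' m.+1 w = chaos o o' m w +
  \sum_t dir_vec o (Ordinal mp) 0 * (D o t (Ordinal mp) w * X t (Ordinal mp) w) *
    partial_sum o' m t w.
Proof. by rewrite /chaos (sum_ord_ltnS mp). Qed.

(** Adding column [m] contributes its cross terms with the two partial sums, which
are the increments of the two [chaos] terms, and a diagonal term. *)
Lemma dot_partial_sum o o' m : (m <= p)%N ->
  \sum_t partial_sum o m t w * partial_sum o' m t w =
  dir_noise o * dir_noise o' * \sum_t e t w ^+ 2 + chaos o o' m w + chaos o' o m w +
  \sum_(j < p | (j < m)%N) dir_vec o j 0 * dir_vec o' j 0 *
     \sum_t D o t j w * D o' t j w * X t j w ^+ 2.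
Proof.
elim: m => [|m IH] mp.
  rewrite /chaos !big_pred0_eq !addr0 mulr_sumr; apply: eq_bigr => t _.
  by rewrite /partial_sum !big_pred0_eq !addr0; ring.
rewrite !chaosS (sum_ord_ltnS mp).
set j := Ordinal mp.
have -> : \sum_t partial_sum o m.+1 t w * partial_sum o' m.+1 t w =
    \sum_t partial_sum o m t w * partial_sum o' m t w +
    \sum_t dir_vec o' j 0 * (D o' t j w * X t j w) * partial_sum o m t w +
    \sum_t dir_vec o j 0 * (D o t j w * X t j w) * partial_sum o' m t w +
    dir_vec o j 0 * dir_vec o' j 0 * \sum_t D o t j w * D o' t j w * X t j w ^+ 2.
  rewrite mulr_sumr -!big_split /=; apply: eq_bigr => t _.
  by rewrite !(partial_sumS _ _ mp) -/j; ring.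
rewrite (IH (ltnW mp)); lra.
Qed.

Variables (rho : R).
Hypothesis rho01 : 0 <= rho < 1.
Hypothesis tau_Ksq : (1 + Ksq) * tau <= 1.
Hypothesis columns : forall f j,
  `|\sum_t mask B f t j w * (X t j w ^+ 2 - n%:R^-1)| <= (1 + Ksq) * tau.
Hypothesis masks : forall j,
  `|n%:R^-1 * \sum_t B t j w - (1 - rho)| <= (1 + expR 1) * tau.
Hypothesis noise : \sum_t e t w ^+ 2 <= 40 * S ^+ 2.
Hypothesis chaosw : chaos_event w.

Lemma column_norm_le f j : \sum_t mask B f t j w * X t j w ^+ 2 <= 2.
Proof.
have := le_trans (columns f j) tau_Ksq; rewrite ler_norml => /andP[_].
under eq_bigr do rewrite mulrBr.
rewrite sumrB -mulr_suml.
have : (\sum_t mask B f t j w) / n%:R <= 1.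
  rewrite ler_pdivrMr// mul1r; apply: (@le_trans _ _ (\sum_(t < n) 1)).
    by apply: ler_sum => t _; have /andP[] := mask_bounds B01 f t j w.
  by rewrite sumr_const card_ord.
lra.
Qed.

Lemma sum_dir_sqr_le1 o (m : nat) : \sum_(j < p | (j < m)%N) dir_vec o j 0 ^+ 2 <= 1.
Proof.
apply: le_trans (dir_vec_norm o); rewrite dot_sqr [leRHS](bigID (fun j : 'I_p => (j < m)%N)) /=.
by rewrite lerDl sumr_ge0// => j _; exact: sqr_ge0.
Qed.

Lemma chaos_energy_le o o' m (C : R) : 0 <= C ->
  (forall j, (j < m)%N -> (j <= p)%N -> \sum_t partial_sum o' j t w ^+ 2 <= C) ->
  chaos_energy o o' m w <= C.
Proof.
move=> C0 h; apply: (@le_trans _ _ (\sum_(j < p | (j < m)%N) dir_vec o j 0 ^+ 2 * C)).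
  apply: ler_sum => j jm; rewrite -mulr_sumr ler_wpM2l ?sqr_ge0//.
  by apply: h => //; exact: ltnW.
by rewrite -mulr_suml ler_piMl// sum_dir_sqr_le1.
Qed.

(** The squared norm is the noise term, at most 40, the diagonal term, at most 2,
and twice [chaos o o m]. By induction the energy in [chaos_event] is at most
100, so that with the multiplier [n / 2] this last term is at most
[4 tau ^ 2 + 50], and the total stays below 100. *)
Lemma partial_sum_norm_le o m : (m <= p)%N -> \sum_t partial_sum o m t w ^+ 2 <= 100.
Proof.
elim/ltn_ind: m => m IH mp.
have en : chaos_energy o o m w <= 100 by apply: chaos_energy_le => // j jm jp; exact: IH.
have := chaosw o o true mp; rewrite ler_norml => /andP[_ h].
have t2 : tau ^+ 2 <= 16^-1 ^+ 2 by rewrite lerXn2r ?nnegrE// ltW.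
have hc : chaos o o m w <= 2 * tau ^+ 2 + 25.
  apply: le_trans h _.
  have -> : n%:R * tau ^+ 2 / lam true = 2 * tau ^+ 2 by rewrite /lam; field; rewrite gt_eqF.
  have -> : lam true / (2 * n%:R) = 4^-1 by rewrite /lam; field; rewrite gt_eqF.
  by lra.
under eq_bigr do rewrite expr2.
rewrite dot_partial_sum//.
have h1 : dir_noise o * dir_noise o * \sum_t e t w ^+ 2 <= 40.
  rewrite -expr2; apply: (@le_trans _ _ (S ^- 2 * (40 * S ^+ 2))).
    apply: ler_pM => //; [exact: sqr_ge0| |exact: dir_noise_sqr].
    by apply: sumr_ge0 => t _; exact: sqr_ge0.
  by rewrite mulrC mulfK// expf_neq0// gt_eqF.
have h2 : \sum_(j < p | (j < m)%N) dir_vec o j 0 * dir_vec o j 0 *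
     (\sum_t D o t j w * D o t j w * X t j w ^+ 2) <= 2.
  apply: (@le_trans _ _ (\sum_(j < p | (j < m)%N) dir_vec o j 0 ^+ 2 * 2)).
    apply: ler_sum => j _; rewrite -expr2 ler_wpM2l ?sqr_ge0//.
    under eq_bigr do rewrite -expr2 mask_sqr//.
    exact: column_norm_le.
  by rewrite -mulr_suml ler_piMl// sum_dir_sqr_le1.
rewrite exprVn in t2; lra.
Qed.

Lemma chaos_le o o' : `|chaos o o' p w| <= 51 * tau.
Proof.
apply: le_trans (chaosw o o' false (leqnn p)) _.
have en : chaos_energy o o' p w <= 100.
  by apply: chaos_energy_le => // j jm jp; exact: partial_sum_norm_le.
have -> : n%:R * tau ^+ 2 / lam false = tau by rewrite /lam; field; rewrite !gt_eqF.
have -> : lam false / (2 * n%:R) = tau / 2 by rewrite /lam; field; rewrite gt_eqF.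
have : tau / 2 * chaos_energy o o' p w <= tau / 2 * 100 by rewrite ler_wpM2l// divr_ge0// ltW.
lra.
Qed.

(** Twice the constant 51 of [chaos_le], plus the constants [1 + Ksq] and
[1 + expR 1] of the deviations of the columns and of the mask. *)
Definition Kdev : R := 104 + Ksq + expR 1.

Lemma masked_column_norm j :
  `|\sum_t B t j w * X t j w ^+ 2 - (1 - rho)| <= (2 + Ksq + expR 1) * tau.
Proof.
have h1 := columns true j; have h2 := masks j.
have -> : \sum_t B t j w * X t j w ^+ 2 - (1 - rho) =
    \sum_t mask B true t j w * (X t j w ^+ 2 - n%:R^-1) + (n%:R^-1 * \sum_t B t j w - (1 - rho)).
  rewrite addrA; congr (_ - _); rewrite mulr_sumr -big_split /=.
  by apply: eq_bigr => t _; ring.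
by apply: le_trans (ler_normD _ _) _; lra.
Qed.

(** At least one of the two directions is masked, so the diagonal carries the
factor [B t j] and has mean [1 - rho]; the noise term vanishes because masked
directions carry no noise. *)
Lemma dot_direction o o' : isSome o || isSome o' ->
  `|\sum_t partial_sum o p t w * partial_sum o' p t w -
      (1 - rho) * dot (dir_vec o) (dir_vec o')| <= Kdev * tau.
Proof.
move=> oo'; rewrite dot_partial_sum//.
have -> : dir_noise o * dir_noise o' = 0.
  by move: oo'; case: o => [?|]; case: o' => [?|] //=; rewrite ?mul0r ?mulr0.
rewrite mul0r add0r.
have -> : (\sum_(j < p | (j < p)%N) dir_vec o j 0 * dir_vec o' j 0 *
    (\sum_t D o t j w * D o' t j w * X t j w ^+ 2)) =
    \sum_j dir_vec o j 0 * dir_vec o' j 0 * \sum_t B t j w * X t j w ^+ 2.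
  apply: eq_big => [j|j _]; first by rewrite ltn_ord.
  congr (_ * _); apply: eq_bigr => t _; congr (_ * _).
  move: oo'; rewrite /D; case: o => [?|]; case: o' => [?|] //= _; rewrite ?mulr1 ?mul1r//.
  by rewrite -expr2; exact: (mask_sqr B01 true).
set M := \sum_j _.
have hM : `|M - (1 - rho) * dot (dir_vec o) (dir_vec o')| <= (2 + Ksq + expR 1) * tau.
  rewrite mulr_sumr -sumrB; apply: le_trans (ler_norm_sum _ _ _) _.
  have c0 : 0 <= (2 + Ksq + expR 1) * tau :> R.
    by rewrite mulr_ge0 ?(ltW tau_gt0)// !addr_ge0 ?expR_ge0 ?Ksq_ge0.
  apply: (@le_trans _ _ (\sum_j (dir_vec o j 0 ^+ 2 + dir_vec o' j 0 ^+ 2) / 2 *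
     ((2 + Ksq + expR 1) * tau))).
    apply: ler_sum => j _.
    have -> : dir_vec o j 0 * dir_vec o' j 0 * (\sum_t B t j w * X t j w ^+ 2) -
      (1 - rho) * (dir_vec o j 0 * dir_vec o' j 0) =
      dir_vec o j 0 * dir_vec o' j 0 * (\sum_t B t j w * X t j w ^+ 2 - (1 - rho)) by ring.
    rewrite normrM; apply: ler_pM => //; last exact: masked_column_norm.
    have := sqr_ge0 (dir_vec o j 0 - dir_vec o' j 0).
    have := sqr_ge0 (dir_vec o j 0 + dir_vec o' j 0).
    by rewrite sqrrD sqrrB ler_norml => ? ?; apply/andP; split; lra.
  rewrite -mulr_suml ler_piMl// -mulr_suml big_split /= -!dot_sqr.
  by have := dir_vec_norm o; have := dir_vec_norm o'; lra.
have h1 := chaos_le o o'; have h2 := chaos_le o' o.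
rewrite -addrA; apply: le_trans (ler_normD _ _) _; rewrite /Kdev.
have := ler_normD (chaos o o' p w) (chaos o' o p w); lra.
Qed.

End Chaos.

(** * Correlations of the wrong picks *)

Section Picks.
Context {d : measure_display} {T : measurableType d} {R : realType}.
Context {P : probability T R} {n p : nat}.
Variables (X : 'I_n -> 'I_p -> {RV P >-> R}) (e : 'I_n -> {RV P >-> R}).
Variable B : 'I_n -> 'I_p -> {RV P >-> R}.
Variables (k G : nat) (beta : 'cV[R]_p) (S tau : R).

Hypothesis indep : mutually_independent (masked_entries X e B).
Hypothesis n_gt0 : (0 < n)%N.
Hypothesis X_sub : forall i j, sub_gaussian (Num.sqrt n%:R)^-1 (X i j).
Hypothesis B01 : forall i j w, B i j w = 0 \/ B i j w = 1.
Hypotheses (tau_gt0 : 0 < tau) (S_gt0 : 0 < S).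

Let nR_gt0 : 0 < n%:R :> R. Proof. by rewrite ltr0n. Qed.

Definition masked_mx w : 'M[R]_(n, p) := \matrix_(t, j) (B t j w * X t j w).
Definition response w : 'cV[R]_n := random_mx X w *m beta + random_cV e w.

Definition picks (c : net_code p k G) : seq 'I_p := [seq (c m).1 | m <- enum 'I_k].

(** The residual when [j] is about to be picked, in the run that follows [s]. *)
Definition pick_residual (s : seq 'I_p) (j : 'I_p) w : 'cV[R]_n :=
  residual (masked_mx w) (response w) (run_set (take (index j s) s)).

Definition wrong_set (s : seq 'I_p) : {set 'I_n * 'I_p} :=
  [set x | (x.2 \in s) && (beta x.2 0 == 0)]%SET.

Definition pick_coef (c : net_code p k G) (x : 'I_n * 'I_p) w : R :=
  n%:R * tau / S * net_vec c x.2 0 * B x.1 x.2 w * pick_residual (picks c) x.2 w x.1 0.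

(** Revealing the wrong columns in the order of [s], the residual is known before
column [x.2] is: it involves [y], to which the wrong columns do not contribute,
and the columns that precede [x.2] in [s]. *)
Lemma before_pick_residual s (x : 'I_n * 'I_p) t :
  measurable_fun setT (fun w : before X e B (wrong_set s) (index^~ s) x =>
     pick_residual s x.2 w t 0).
Proof.
apply: (@mx_measurable_residual _ (before X e B (wrong_set s) (index^~ s) x)
  R n p masked_mx response).
  move=> i j jI; apply: (eq_measurable_fun (fun w : before X e B (wrong_set s) (index^~ s) x =>
    B i j w * X i j w)).
    by move=> w _; rewrite mxE.
  apply: measurable_funM; first exact: before_mask.
  apply: before_design; apply/orP; right.
  by move: jI; rewrite inE; apply: index_ltn.
move=> i j; rewrite ord1.
apply: (eq_measurable_fun (fun w : before X e B (wrong_set s) (index^~ s) x =>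
  \sum_l X i l w * beta l 0 + e i w)).
  by move=> w _; rewrite !mxE; congr (_ + _); apply: eq_bigr => l _; rewrite mxE.
apply: measurable_funD; last exact: before_noise.
apply: measurable_sum => l.
have [bl|bl] := eqVneq (beta l 0) 0.
  apply: (eq_measurable_fun (fun _ : before X e B (wrong_set s) (index^~ s) x => 0 : R)) => //.
  by move=> w _; rewrite bl mulr0.
apply: measurable_funM => //; apply: before_design.
by rewrite inE /= (negPf bl) andbF.
Qed.

(** The code [c] gives both a sequence of picks and the coordinates of a test
vector for the correlations at these picks. *)
Definition picks_event w := forall c : net_code p k G,
  \sum_(x in wrong_set (picks c)) pick_coef c x w * X x.1 x.2 w <=
  n%:R * tau ^+ 2 + (2 * n%:R)^-1 * \sum_(x in wrong_set (picks c)) pick_coef c x w ^+ 2.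

Lemma high_probability_picks :
  with_probability_at_least P
    (1 - ((p * (2 * G).+1) ^ k)%:R * expR (- (n%:R * tau ^+ 2)))
    [set w | picks_event w].
Proof.
have cardF : #|{: net_code p k G}| = ((p * (2 * G).+1) ^ k)%N.
  by rewrite card_ffun card_prod !card_ord.
rewrite -cardF.
apply: (@high_probability_linear _ _ _ P n p X e B indep (net_code p k G)
  (fun c => wrong_set (picks c)) (fun c j => index j (picks c)) pick_coef _ X_sub).
move=> c x _; apply: measurable_funM; last exact: before_pick_residual.
by apply: measurable_funM => //; exact: before_mask.
Qed.

Lemma sum_wrong_set (s : k.-tuple 'I_p) (F : 'I_n * 'I_p -> R) : uniq s ->
  \sum_(x in wrong_set s) F x =
  \sum_(i < k | beta (tnth s i) 0 == 0) \sum_t F (t, tnth s i).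
Proof.
move=> us; rewrite -(big_tuple _ _ s (fun j => beta j 0 == 0) (fun j => \sum_t F (t, j))).
rewrite [RHS]big_mkcond (big_uniq _ us) -big_mkcondr /= exchange_big pair_big_dep /=.
by apply: eq_big => [[t j]|[t j] _] //; rewrite inE.
Qed.

Variable w : T.
Hypothesis picksw : picks_event w.
Hypothesis residual_le : forall I : {set 'I_p}, (#|I| <= 2 * k)%N ->
  let r := residual (masked_mx w) (response w) I in dot r r <= 100 * S ^+ 2.
Hypothesis Gk : (4 * k <= G ^ 2)%N.
Hypothesis G_gt0 : (0 < G)%N.

(** The norm of the vector of wrong correlations is at most twice its inner
product with a grid vector in the unit ball, by [grid_round]; this inner product
is the linear form of [picks_event]. *)
Lemma wrong_picks_le (s : k.-tuple 'I_p) : uniq s ->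
  \sum_(i < k | beta (tnth s i) 0 == 0)
    correlation (masked_mx w) (residual (masked_mx w) (response w) (run_set (take i s)))
      (tnth s i) ^+ 2 <= (102 * tau * S) ^+ 2.
Proof.
move=> us; pose cor (i : 'I_k) := correlation (masked_mx w)
  (residual (masked_mx w) (response w) (run_set (take i s))) (tnth s i).
pose g (i : 'I_k) := if beta (tnth s i) 0 == 0 then cor i else 0.
have [|gam [gam1 _ gamg]] := @grid_round R _ G g G_gt0; first by rewrite card_ord.
pose c : net_code p k G := [ffun i => (tnth s i, gam i)].
have sc : picks c = s.
  rewrite -[RHS]map_tnth_enum; apply: eq_map => i; by rewrite ffunE.
have raw (i : 'I_k) : net_raw c (tnth s i) 0 = grid_val (gam i) :> R.
  rewrite mxE (bigD1 i)/= ?ffunE//= big1 ?addr0// => i'.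
  rewrite ffunE /= => /andP[/eqP ii ni].
  by move/tuple_uniqP: us => /(_ _ _ ii) ie; rewrite ie eqxx in ni.
have vE : net_vec c = net_raw c :> 'cV[R]_p.
  rewrite /net_vec ifT// dot_net_raw; apply: le_trans gam1; apply: ler_sum => i _.
  by rewrite ffunE /= raw expr2.
have idx (i : 'I_k) : index (tnth s i) s = i.
  by rewrite (tnth_nth (tnth s i)) index_uniq// size_tuple.
have hp := picksw c; rewrite sc !sum_wrong_set// in hp.
have S0 := ltW S_gt0; have c0 : 0 < n%:R * tau / S by rewrite divr_gt0// mulr_gt0.
have lhs : \sum_(i < k | beta (tnth s i) 0 == 0) \sum_t
    pick_coef c (t, tnth s i) w * X t (tnth s i) w =
    n%:R * tau / S * \sum_i grid_val (gam i) * g i.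
  rewrite mulr_sumr big_mkcond; apply: eq_bigr => i _; rewrite /g.
  case: ifP => _; last by rewrite !mulr0.
  rewrite /cor correlationE mxE !mulr_sumr; apply: eq_bigr => t _.
  rewrite /pick_coef /= vE raw sc /pick_residual idx !mxE; ring.
have rhs : \sum_(i < k | beta (tnth s i) 0 == 0) \sum_t pick_coef c (t, tnth s i) w ^+ 2 <=
    (n%:R * tau / S) ^+ 2 * (100 * S ^+ 2).
  apply: (@le_trans _ _ (\sum_i (n%:R * tau / S) ^+ 2 * (grid_val (gam i) ^+ 2 * (100 * S ^+ 2)))).
    rewrite big_mkcond; apply: ler_sum => i _; case: ifP => _; last first.
      apply: mulr_ge0; first exact: sqr_ge0.
      apply: mulr_ge0; first exact: sqr_ge0.
      by apply: mulr_ge0 => //; exact: sqr_ge0.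
    apply: (@le_trans _ _ ((n%:R * tau / S) ^+ 2 * (grid_val (gam i) ^+ 2 *
        \sum_t pick_residual s (tnth s i) w t 0 ^+ 2))).
      rewrite !mulr_sumr; apply: ler_sum => t _; rewrite /pick_coef /= vE raw sc.
      set z := pick_residual _ _ _ _ _; set b := B t _ w; set a := n%:R * tau / S.
      have -> : (a * grid_val (gam i) * b * z) ^+ 2 =
        b ^+ 2 * (a ^+ 2 * (grid_val (gam i) ^+ 2 * z ^+ 2)) by ring.
      rewrite ler_piMl//; last by rewrite /b; case: (B01 t (tnth s i) w) => ->; rewrite ?expr0n ?expr1n ?ler01.
      apply: mulr_ge0; first exact: sqr_ge0.
      by apply: mulr_ge0; exact: sqr_ge0.
    rewrite ler_wpM2l ?sqr_ge0// ler_wpM2l ?sqr_ge0// -dot_sqr; apply: residual_le.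
    rewrite /run_set cardsE (leq_trans (card_size _))// size_take_min size_tuple idx.
    by rewrite (leq_trans (geq_minr _ _))// leq_pmull.
  rewrite -mulr_sumr -mulr_suml; apply: ler_wpM2l; first exact: sqr_ge0.
  by rewrite ler_piMl//; apply: mulr_ge0 => //; exact: sqr_ge0.
rewrite lhs in hp.
have key : \sum_i grid_val (gam i) * g i <= 51 * tau * S.
  rewrite -(ler_pM2l c0); apply: le_trans hp _.
  have -> : n%:R * tau / S * (51 * tau * S) = n%:R * tau ^+ 2 +
      (2 * n%:R)^-1 * ((n%:R * tau / S) ^+ 2 * (100 * S ^+ 2)).
    by field; rewrite !gt_eqF.
  rewrite lerD2l; apply: ler_wpM2l; last exact: rhs.
  by rewrite invr_ge0 mulr_ge0// ltW.
have gsum : \sum_(i < k | beta (tnth s i) 0 == 0) cor i ^+ 2 = \sum_i g i ^+ 2.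
  rewrite big_mkcond; apply: eq_bigr => i _; rewrite /g; case: ifP => //.
  by rewrite expr0n.
have gle : Num.sqrt (\sum_i g i ^+ 2) <= 102 * tau * S by lra.
have g0 : 0 <= \sum_i g i ^+ 2 by apply: sumr_ge0 => i _; exact: sqr_ge0.
rewrite gsum -(sqr_sqrtr g0) lerXn2r ?nnegrE ?sqrtr_ge0//.
by rewrite !mulr_ge0// ltW.
Qed.
End Picks.

(** * The error of modified OMP *)

Section GoodEvent.
Context {d : measure_display} {T : measurableType d} {R : realType}.
Context {P : probability T R} {n p : nat}.
Variables (X : 'I_n -> 'I_p -> {RV P >-> R}) (e : 'I_n -> {RV P >-> R}).
Variable B : 'I_n -> 'I_p -> {RV P >-> R}.
Variables (k : nat) (beta : 'cV[R]_p) (rho S tau : R).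

Hypotheses (n_gt0 : (0 < n)%N) (p_gt0 : (0 < p)%N) (k_gt0 : (0 < k)%N).
Hypothesis B01 : forall i j w, B i j w = 0 \/ B i j w = 1.
Hypothesis rho01 : 0 <= rho < 1.
Hypotheses (tau_gt0 : 0 < tau) (tau_small : 16 * Kdev * tau <= (1 - rho) ^+ 2).
Hypotheses (S_gt0 : 0 < S) (beta_S : l2norm beta <= S).
Hypothesis card_supp : #|[set i : 'I_p | beta i 0 != 0]%SET| = k.

Variable w : T.
Hypothesis columns : forall f j,
  `|\sum_t mask B f t j w * (X t j w ^+ 2 - n%:R^-1)| <= (1 + Ksq) * tau.
Hypothesis masks : forall j,
  `|n%:R^-1 * \sum_t B t j w - (1 - rho)| <= (1 + expR 1) * tau.
Hypothesis noise : \sum_t e t w ^+ 2 <= 40 * S ^+ 2.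
Hypothesis chaosw : chaos_event X e B (2 * k) (4 * k) beta S tau w.
Hypothesis picksw : picks_event X e B k (4 * k) beta S tau w.

Let q := 1 - rho.
Let Z := masked_mx X B w.
Let y := response X e beta w.
Let eta := 4 * Kdev * tau.

Let q_gt0 : 0 < q. Proof. by rewrite /q; case/andP: rho01; lra. Qed.
Let q_le1 : q <= 1. Proof. by rewrite /q; case/andP: rho01; lra. Qed.

Let Kdev_ge : 104 + Ksq <= Kdev :> R.
Proof. by rewrite /Kdev lerDl expR_ge0. Qed.

Let Kdev_ge1 : 1 <= Kdev :> R.
Proof. by have := @Ksq_ge0 R; have := Kdev_ge; lra. Qed.

Let Kdev_tau : 16 * Kdev * tau <= 1.
Proof. by apply: le_trans tau_small _; apply: exprn_ile1; [exact: ltW q_gt0|exact: q_le1]. Qed.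

Let tau_le : tau <= 16^-1.
Proof.
have : 16 * 1 * tau <= 16 * Kdev * tau by rewrite ler_pM2r// ler_pM2l.
by have := Kdev_tau; lra.
Qed.

Let tau_Ksq : (1 + Ksq) * tau <= 1.
Proof.
have : (1 + Ksq) * tau <= (16 * Kdev) * tau by rewrite ler_pM2r//; have := Kdev_ge; have := Kdev_ge1; lra.
by have := Kdev_tau; lra.
Qed.

Let G_big : (4 * (2 * k) <= (4 * k) ^ 2)%N.
Proof. by rewrite mulnA expnMn leq_mul// -mulnn leq_pmulr. Qed.

Let dirE := dot_direction n_gt0 B01 tau_gt0 tau_le S_gt0 beta_S tau_Ksq columns masks noise chaosw.

Lemma masked_mul_net (c : net_code p (2 * k) (4 * k)) t :
  (Z *m net_vec c) t 0 = partial_sum X e B beta S (Some c) p t w.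
Proof.
rewrite /partial_sum mul0r add0r mxE; apply: eq_big => [l|l _]; first by rewrite ltn_ord.
by rewrite mxE /= mulrC.
Qed.

Lemma responseE t :
  y t 0 = S * partial_sum X e B beta S (None : option (net_code p (2 * k) (4 * k))) p t w.
Proof.
rewrite /partial_sum mulrDr mulrA mulfV ?gt_eqF// mul1r addrC !mxE; congr (_ + _).
rewrite mulr_sumr; apply: eq_big => [l|l _]; first by rewrite ltn_ord.
by rewrite !mxE /= mul1r; field; rewrite gt_eqF.
Qed.

Lemma near_isometry_good (U : {set 'I_p}) (u v : 'cV[R]_p) : (#|U| <= 2 * k)%N ->
  supported_on U u -> supported_on U v ->
  `|dot (Z *m u) (Z *m v) - q * dot u v| <= eta * l2norm u * l2norm v.
Proof.
move=> Uk su sv; pose M := Z^T *m Z - q%:M.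
have ME a b : dot a (M *m b) = dot (Z *m a) (Z *m b) - q * dot a b.
  by rewrite mulmxBl dotBr -mulmxA -dot_mulmx_trmx mul_scalar_mx dotZr.
rewrite -ME /eta -[4 * Kdev * tau]mulrA.
apply: (net_bilinear_bound p_gt0 _ G_big Uk su sv); first by rewrite muln_gt0.
move=> c c'; rewrite ME.
have := dirE (o := Some c) (o' := Some c') isT.
rewrite /dot; under eq_bigr do rewrite -!masked_mul_net.
exact.
Qed.

Lemma near_unbiased_good (U : {set 'I_p}) (u : 'cV[R]_p) : (#|U| <= 2 * k)%N ->
  supported_on U u ->
  `|dot (Z *m u) y - q * dot u beta| <= eta * S * l2norm u.
Proof.
move=> Uk su; pose g := Z^T *m y - q *: beta.
have gE a : dot a g = dot (Z *m a) y - q * dot a beta.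
  by rewrite dotBr -dot_mulmx_trmx dotZr.
rewrite -gE.
have Kt : 0 <= Kdev * tau * S by rewrite !mulr_ge0 ?(ltW tau_gt0) ?(ltW S_gt0)//; have := Kdev_ge1; lra.
apply: (@le_trans _ _ (2 * (Kdev * tau * S) * l2norm u)); last first.
  by rewrite ler_wpM2r ?l2norm_ge0//; rewrite /eta; lra.
apply: (net_linear_bound p_gt0 _ G_big Uk su); first by rewrite muln_gt0.
move=> c _; rewrite gE.
have := dirE (o := Some c) (o' := None) isT.
rewrite ler_norml => /andP[_] /(ler_wpM2l (ltW S_gt0)).
rewrite mulrBr mulr_sumr dotZr [leRHS]mulrC.
have -> : S * ((1 - rho) * (S^-1 * dot (net_vec c) beta)) = q * dot (net_vec c) beta.
  by rewrite /q; field; rewrite gt_eqF.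
have -> : \sum_t S * (partial_sum X e B beta S (Some c) p t w *
     partial_sum X e B beta S (None : option (net_code p (2 * k) (4 * k))) p t w) = dot (Z *m net_vec c) y.
  by apply: eq_bigr => t _; rewrite masked_mul_net responseE; ring.
by [].
Qed.

Lemma response_norm_le : dot y y <= 100 * S ^+ 2.
Proof.
rewrite dot_sqr; under eq_bigr do rewrite responseE exprMn.
rewrite -mulr_sumr mulrC ler_pM2r ?exprn_gt0//.
exact: (partial_sum_norm_le n_gt0 B01 tau_gt0 tau_le S_gt0 beta_S tau_Ksq columns noise chaosw).
Qed.

(** With [eta = 4 Kdev tau], the isometry bounds on the net extend to all sparse
vectors; the residuals, being projections of [y], have squared norm at most
[100 S ^ 2], as [wrong_picks_le] requires. *)
Lemma mod_omp_good :
  mod_omp_output_satisfies Z y rho k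
    (fun b => l2norm (b - beta) <= 8 * eta * S / q + 4 * eta * l2norm beta / q ^+ 2).
Proof.
have eta_small : 4 * eta <= q ^+ 2 by apply: le_trans tau_small; rewrite /eta; lra.
have Kt : 0 <= Kdev * tau by rewrite mulr_ge0 ?(ltW tau_gt0)//; have := Kdev_ge1; lra.
have eta0 : 0 <= eta by rewrite /eta; lra.
apply: (mod_omp_error q_gt0 q_le1 (ltW S_gt0) eta0 eta_small beta_S card_supp
  near_isometry_good near_unbiased_good) => // s us.
have h : forall I : {set 'I_p}, (#|I| <= 2 * k)%N ->
    let r := residual Z y I in dot r r <= 100 * S ^+ 2.
  move=> I Ik; apply: le_trans response_norm_le.
  exact: (residual_norm_le y q_gt0 q_le1 eta_small near_isometry_good Ik).
have Gk : (4 * k <= (4 * k) ^ 2)%N by rewrite -mulnn leq_pmulr// muln_gt0.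
have G0 : (0 < 4 * k)%N by rewrite muln_gt0.
apply: le_trans (wrong_picks_le n_gt0 B01 tau_gt0 S_gt0 picksw h Gk G0 us) _.
have t0 := ltW tau_gt0; have S0 := ltW S_gt0.
have h1 : 102 * tau * S <= eta * S.
  by rewrite ler_pM2r// /eta ler_pM2r//; have := Kdev_ge; have := @Ksq_ge0 R; lra.
have h2 : 0 <= 102 * tau * S by rewrite !mulr_ge0.
have h3 : 0 <= eta * S by rewrite mulr_ge0.
by rewrite lerXn2r ?nnegrE.
Qed.
End GoodEvent.

(** The number of exponential inequalities used in total. Since [k <= p], a grid
with [8 k + 1] values per coordinate has size polynomial in [p]. *)
Lemma union_bound_count (p k : nat) : (1 < p)%N -> (0 < k)%N -> (k <= p)%N ->
  (4 * p + (2 * p + (1 + ((((p * (2 * (4 * k)).+1) ^ (2 * k)).+1 ^ 2 * (4 * p.+1)) +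
     (p * (2 * (4 * k)).+1) ^ k))) <= 5 * p ^ (30 * k))%N.
Proof.
move=> p1 k0 kp; have p0 : (0 < p)%N by apply: ltn_trans p1.
have mono a b : (a <= b)%N -> (p ^ a <= p ^ b)%N by move=> ab; rewrite leq_pexp2l.
have two a : (2 ^ a <= p ^ a)%N by case: a => // a; rewrite leq_exp2r.
set Q := (p * (2 * (4 * k)).+1)%N.
have Qle : (Q <= p ^ 6)%N.
  apply: (@leq_trans (p * (p * p ^ 4))); last by rewrite -!expnS.
  rewrite leq_mul2l; apply/orP; right.
  by apply: (@leq_trans (p * 2 ^ 4)); [lia|rewrite leq_mul2l two orbT].
have Q0 : (0 < Q)%N by rewrite muln_gt0 p0.
have Qk : (Q ^ k <= p ^ (30 * k))%N.
  apply: leq_trans (_ : (p ^ 6) ^ k <= _)%N; first by rewrite leq_exp2r.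
  by rewrite -expnM; apply: mono; lia.
have Q2k : (Q ^ (2 * k) <= p ^ (12 * k))%N.
  apply: leq_trans (_ : (p ^ 6) ^ (2 * k) <= _)%N; first by rewrite leq_exp2r// muln_gt0.
  by rewrite -expnM; apply: mono; lia.
have hp (a : nat) : (a <= 4)%N -> (2 ^ a * p <= p ^ (30 * k))%N.
  move=> a4; apply: leq_trans (_ : p ^ a * p <= _)%N; first by rewrite leq_mul2r two orbT.
  by rewrite -expnSr; apply: mono; lia.
have big : ((Q ^ (2 * k)).+1 ^ 2 * (4 * p.+1) <= p ^ (30 * k))%N.
  have h1 : ((Q ^ (2 * k)).+1 <= p ^ (12 * k + 1))%N.
    rewrite addn1 expnS; have := expn_gt0 p (12 * k); rewrite p0 => /= h.
    by apply: leq_trans (_ : 2 * p ^ (12 * k) <= _)%N; [lia|rewrite leq_mul2r p1 orbT].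
  have h2 : (4 * p.+1 <= p ^ 4)%N.
    rewrite -[4%N]/(2 + 2)%N [leqRHS]expnD leq_mul//; first exact: (two 2).
    by rewrite -mulnn; case: (p) p1 => // -[|x] // _; lia.
  apply: leq_trans (_ : (p ^ (12 * k + 1)) ^ 2 * p ^ 4 <= _)%N.
    by rewrite leq_mul// leq_exp2r.
  by rewrite -expnM -expnD; apply: mono; lia.
have h2 := hp 2 isT; have h1 := hp 1%N isT.
have h0 : (1 <= p ^ (30 * k))%N by rewrite expn_gt0 p0.
rewrite expnS expn1 in h2; rewrite expn1 in h1.
rewrite (_ : 5 * _ = p ^ (30 * k) + (p ^ (30 * k) + (p ^ (30 * k) + (p ^ (30 * k) + p ^ (30 * k)))))%N; last lia.
by rewrite !leq_add.
Qed.

Theorem corollary23 (R : realType) :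
  exists c C C1 C2 : R, [/\ 0 < c, 0 < C, 0 < C1 & 0 < C2] /\
  forall (n p k : nat) (rho sigma_e : R) (beta : 'cV[R]_p)
    (d : measure_display) (T : measurableType d) (P : probability T R)
    (X : 'I_n -> 'I_p -> {RV P >-> R}) (e : 'I_n -> {RV P >-> R})
    (Z : 'I_n -> 'I_p -> {RV P >-> R}),
  (0 < n)%N -> (0 < p)%N ->
  0 <= rho < 1 -> 0 <= sigma_e ->
  #|[set i : 'I_p | beta i 0 != 0]%SET| = k ->
  sub_gaussian_design sigma_e X e ->
  missing_data rho X e Z ->
  c * ((1 - rho) ^+ 4)^-1 * (k%:R * ln p%:R) <= n%:R ->
  (forall i, beta i 0 != 0 ->
     16 / (1 - rho) * (l2norm beta + sigma_e) * Num.sqrt (ln p%:R / n%:R)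
       < `|beta i 0|) ->
  with_probability_at_least P (1 - C1 * p%:R `^ (- C2))
    [set w | mod_omp_output_satisfies
       (random_mx Z w)
       (random_mx X w *m beta + random_cV e w)
       rho k
       (fun b => l2norm (b - beta) <=
          C * (((1 - rho) ^+ 2)^-1 * l2norm beta + (1 - rho)^-1 * sigma_e)
            * Num.sqrt (k%:R * ln p%:R / n%:R))].
Proof.
have K0 : 0 < Kdev :> R.
  by rewrite /Kdev; have := @Ksq_ge0 R; have := @expR_ge0 R 1; lra.
(* The factor 31 in [n tau ^+ 2 = 31 k log p] leaves a factor [p ^- k] after the
   union bound over [5 * p ^ (30 * k)] events; [c] is such that
   [16 Kdev tau <= (1 - rho) ^+ 2]. *)
exists (31 * (16 * Kdev) ^+ 2), (48 * Kdev * Num.sqrt 31), 5, 1.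
split.
  split=> //; first by rewrite mulr_gt0// exprn_gt0// mulr_gt0.
  by rewrite !mulr_gt0// sqrtr_gt0.
move=> n p k rho sigma_e beta d T P X e Z n0 p0 rho01 sig0 card_supp design missing n_big _.
case: missing => B [indep _ B1 B01 ZE].
case: design => _ X_var X_sub e_sub.
have q0 : 0 < 1 - rho by case/andP: rho01; lra.
have q1 : 1 - rho <= 1 by case/andP: rho01; lra.
have ZmE w : random_mx Z w = masked_mx X B w.
  by apply/matrixP => i j; rewrite !mxE ZE.
(* For [p = 1] the claimed probability is negative. *)
have [p1|p1] := leqP p 1.
  have {p1}pE : p = 1%N by apply/eqP; rewrite eqn_leq p1.
  exists set0; split=> //; rewrite measure0 lee_fin pE powR1; lra.
have nR : 0 < n%:R :> R by rewrite ltr0n.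
have pR : 1 < p%:R :> R by rewrite ltr1n.
have L0 : 0 < ln p%:R :> R by rewrite ln_gt0.
(* For [k = 0] both [beta] and the estimate vanish, on the whole space. *)
have [k0|k0] := posnP k.
  have b0 : beta = 0.
    apply/colP => i; rewrite mxE; apply/eqP; apply: contraT => bi.
    move: card_supp; rewrite k0 => /eqP; rewrite cards_eq0 => /eqP /finset.setP /(_ i).
    by rewrite !inE bi.
  exists setT; split=> //; last first.
    rewrite probability_setT lee_fin; have := powR_ge0 (p%:R : R) (- 1); lra.
  move=> w _ /= I b run.
  have nb0 : l2norm beta <= 0 by rewrite b0 l2normE /dot big1 ?sqrtr0// => i _; rewrite mxE mul0r.
  have empty (U : {set 'I_p}) (u : 'cV[R]_p) : (#|U| <= 2 * k)%N -> supported_on U u -> u = 0.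
    rewrite k0 leqn0 cards_eq0 => /eqP U0 su; apply/colP => i.
    by rewrite su ?mxE// U0 inE.
  have z0 m : dot (0 : 'cV[R]_m) 0 = 0 by rewrite /dot big1// => i _; rewrite mxE mul0r.
  have z1 m (v : 'cV[R]_m) : dot 0 v = 0 by rewrite /dot big1// => i _; rewrite mxE mul0r.
  have [] := @mod_omp_error R n p (random_mx Z w) (random_mx X w *m beta + random_cV e w) beta
    (1 - rho) 0 0 k q0 q1 (lexx _) (lexx _) _ nb0 card_supp _ _ _ rho erefl I b run.
  - by rewrite mulr0 sqr_ge0.
  - move=> U u v Uk su sv; rewrite (empty _ _ Uk su) mulmx0 !z1 mulr0 subr0 normr0 mul0r.
    by rewrite mul0r.
  - by move=> U u Uk su; rewrite (empty _ _ Uk su) mulmx0 !z1 mulr0 subr0 normr0 !mul0r.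
  - move=> s _; rewrite big1 ?mulr0 ?expr0n// => i _.
    by exfalso; move: (ltn_ord i); rewrite [X in (_ < X)%N]k0.
  - move=> gu su; rewrite !mulr0 !mul0r addr0 => h; split=> //.
    by apply: le_trans h _; rewrite k0 !mul0r sqrtr0 mulr0.
have kR : 0 < k%:R :> R by rewrite ltr0n.
have kp : (k <= p)%N by rewrite -card_supp -[leqRHS](card_ord p) max_card.
pose S := l2norm beta + sigma_e.
have b0 : 0 < l2norm beta.
  rewrite lt_neqAle l2norm_ge0 eq_sym andbT; apply/negP => /eqP /l2norm_eq0 bz.
  move: k0; rewrite -card_supp card_gt0 => /set0Pn[i]; rewrite inE bz mxE eqxx//.
have S0 : 0 < S by rewrite /S; lra.
have bS : l2norm beta <= S by rewrite /S; lra.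
have sS : sigma_e <= S by rewrite /S; lra.
pose t0 := k%:R * ln p%:R / n%:R : R.
have t00 : 0 < t0 by rewrite divr_gt0// mulr_gt0.
pose tau := Num.sqrt 31 * Num.sqrt t0.
have tau0 : 0 < tau by rewrite mulr_gt0// sqrtr_gt0.
have tau2 : n%:R * tau ^+ 2 = 31 * (k%:R * ln p%:R).
  rewrite /tau exprMn !sqr_sqrtr ?ltW// /t0; field; rewrite gt_eqF//.
have tau_small : 16 * Kdev * tau <= (1 - rho) ^+ 2.
  have h0 : 0 <= 16 * Kdev * tau by rewrite !mulr_ge0// ltW.
  rewrite -(@ler_pXn2r _ 2)// ?nnegrE ?sqr_ge0// -exprM.
  rewrite exprMn -(ler_pM2l nR) mulrCA tau2.
  move: n_big; rewrite mulrAC ler_pdivrMr ?exprn_gt0//; lra.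
have tau16 : tau <= 16^-1.
  have h1 : (1 - rho) ^+ 2 <= 1 by apply: exprn_ile1 => //; exact: ltW.
  have h2 : 1 <= Kdev :> R.
    by rewrite /Kdev; have := @Ksq_ge0 R; have := @expR_ge0 R 1; lra.
  have : 16 * 1 * tau <= 16 * Kdev * tau by rewrite ler_pM2r// ler_pM2l.
  lra.
have H := high_probabilityI (high_probability_columns indep n0 X_var X_sub B01 tau0 tau16)
  (high_probabilityI (high_probability_mask indep n0 rho01 B1 B01 tau0 tau16)
  (high_probabilityI (high_probability_noise indep n0 e_sub sig0 tau0 tau16 S0 sS)
  (high_probabilityI (high_probability_chaos (2 * k) (4 * k) beta S indep n0 X_sub B01 tau0)
    (high_probability_picks k (4 * k) beta S tau indep X_sub)))).
apply: high_probability_mono _ _ H.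
- rewrite tau2 lerD2l lerN2.
  set E := expR _.
  have EE : E = (p%:R ^+ (30 * k))^-1 * (p%:R ^+ k)^-1.
    rewrite /E expRN -invfM -exprD; congr (_^-1).
    have -> : 31 * (k%:R * ln p%:R) = (30 * k + k)%:R * ln p%:R :> R.
      by rewrite natrD natrM; ring.
    by rewrite expRM_natl lnK// posrE ltr0n.
  have E0 : 0 < E by exact: expR_gt0.
  apply: (@le_trans _ _ ((5 * p ^ (30 * k))%:R * E)).
    have := union_bound_count p1 k0 kp; rewrite -(ler_nat R) => /(ler_wpM2r (ltW E0)) h.
    apply: le_trans h; rewrite !natrD !mulrDl mul1r; lra.
  rewrite natrM -mulrA ler_pM2l// EE natrX powR_inv1 ?ler0n//.
  have pR0 : 0 < p%:R :> R by rewrite ltr0n.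
  rewrite mulrA mulfV ?expf_neq0 ?gt_eqF// mul1r.
  rewrite lef_pV2 ?posrE ?exprn_gt0//.
  by rewrite -[leLHS]expr1 ler_eXn2l.
- move=> w [/= hc [hm [hn [hch hp]]]] I b run.
  have [] := @mod_omp_good _ _ _ _ _ _ X e B k beta rho S tau n0 p0 k0 B01 rho01 tau0 tau_small
    S0 bS card_supp w hc hm hn hch hp I b; first by rewrite -ZmE.
  rewrite -ZmE => gu su h; split=> //; apply: le_trans h _.
  rewrite /tau -/t0; set s31 := Num.sqrt 31; set st := Num.sqrt t0; set q := 1 - rho.
  have hS : S / q <= l2norm beta / q ^+ 2 + sigma_e / q.
    rewrite /S mulrDl lerD2r ler_wpM2l ?l2norm_ge0// lef_pV2 ?posrE ?exprn_gt0//.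
    by rewrite expr2 ger_pMl.
  have M0 : 0 <= 32 * Kdev * (s31 * st) by rewrite !mulr_ge0 ?sqrtr_ge0// ltW.
  have M1 : 0 <= 16 * Kdev * (s31 * st) by rewrite !mulr_ge0 ?sqrtr_ge0// ltW.
  have h1 := ler_wpM2l M0 hS.
  have s0 : 0 <= sigma_e / q by rewrite divr_ge0// ltW.
  have h2 : l2norm beta / q ^+ 2 <= l2norm beta / q ^+ 2 + sigma_e / q by rewrite lerDl.
  have h3 := ler_wpM2l M1 h2.
  have -> : 8 * (4 * Kdev * (s31 * st)) * S / q + 4 * (4 * Kdev * (s31 * st)) * l2norm beta / q ^+ 2 =
    32 * Kdev * (s31 * st) * (S / q) + 16 * Kdev * (s31 * st) * (l2norm beta / q ^+ 2) by ring.
  have -> : 48 * Kdev * s31 * ((q ^+ 2)^-1 * l2norm beta + q^-1 * sigma_e) * st =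
    32 * Kdev * (s31 * st) * (l2norm beta / q ^+ 2 + sigma_e / q) +
    16 * Kdev * (s31 * st) * (l2norm beta / q ^+ 2 + sigma_e / q) by ring.
  exact: lerD.
Qed.
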